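(* Let $d,n$ be positive integers and let $\underline l=(l_0,l_1,\dots,l_{n-1})$ be a Kupisch series of type $\mathbb A_n$, i.e. a sequence of positive integers with $l_0=1$ and $2\le l_i\le l_{i-1}+1$ for all $i\ge1$. Let $L_n^d$ be the lattice, ordered by inclusion, of $d$-torsion classes of $\mathcal M_n^d$ (higher Auslander algebra $A_n^d$ of type $\mathbb A$), and let $L_{\underline l}^d$ be the lattice, ordered by inclusion, of $d$-torsion classes of $\mathcal M_{\underline l}^d$ (higher Nakayama algebra $A_{\underline l}^d$ of type $\mathbb A$ associated to $\underline l$). Then $L_{\underline l}^d$ is a lattice quotient of $L_n^d$, i.e. it is isomorphic to the quotient of $L_n^d$ by a lattice congruence. It inherits the properties of the lattices $\mathrm{Tam}(P,\phi)$ that are preserved by lattice quotients (any isomorphism-invariant property of finite lattices which holds for all $\mathrm{Tam}(P,\phi)$ and is preserved by lattice quotients holds for $L_{\underline l}^d$). In particular, $L_{\underline l}^d$ is a join-semidistributive lattice.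
   Context: Combinatorics. $os_n^d$ is the set of non-decreasing sequences of length $d$ with entries in $\{0,1,\dots,n-1\}$. Put $os_{\underline l}^{d+1}:=\{y=(y_1,\dots,y_{d+1})\in os_n^{d+1}\mid y_1\ge y_{d+1}-l_{y_{d+1}}+1\}$. Higher Auslander algebras of type $\mathbb A$. Let $K$ be a field. $A_n^d$ is the algebra of the quiver with vertex set $os_n^d$ and an arrow $y\to y-e_i$ whenever $y,y-e_i\in os_n^d$ ($e_i$ the $i$-th unit vector), modulo the relations: whenever $i\neq j$ and $y,\,y-e_i-e_j\in os_n^d$, the paths $y\to y-e_i\to y-e_i-e_j$ and $y\to y-e_j\to y-e_i-e_j$ are equal, a path through a sequence not in $os_n^d$ being read as $0$. Finite-dimensional modules are the finite-dimensional representations of this quiver satisfying these relations. For $x\in os_n^{d+1}$, $M_x$ is the representation with $K$ at each vertex $y$ such that $x_1\le y_1\le x_2\le y_2\le\dots\le x_d\le y_d\le x_{d+1}$, $0$ at the other vertices, and identity maps on all arrows between vertices carrying $K$. $\mathcal M_n^d$ is the full subcategory of finite direct sums of copies of the $M_x$, $x\in os_n^{d+1}$; it is a $d$-cluster tilting subcategory of the category of finite-dimensional $A_n^d$-modules. Higher Nakayama algebras of type $\mathbb A$. $A_{\underline l}^d$ is the quotient of $A_n^d$ by the annihilator of $\bigoplus_{x\in os_{\underline l}^{d+1}}M_x$, and $\mathcal M_{\underline l}^d$ is the full subcategory of finite direct sums of copies of the $M_x$, $x\in os_{\underline l}^{d+1}$; it is a $d$-cluster tilting subcategory of the category of finite-dimensional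 $A_{\underline l}^d$-modules. $d$-torsion classes. A full subcategory $\mathcal U$ of a $d$-cluster tilting subcategory $\mathcal M$ (closed under isomorphisms, finite direct sums and direct summands) is a $d$-torsion class if for every $M\in\mathcal M$ there is an exact sequence $0\to U_M\to M\to V_1\to\dots\to V_d\to 0$ with all terms in $\mathcal M$ and $U_M\in\mathcal U$, such that for every $U\in\mathcal U$ the sequence $0\to\mathrm{Hom}(U,V_1)\to\dots\to\mathrm{Hom}(U,V_d)\to0$ is exact. Lattices. A lattice congruence is an equivalence relation compatible with $\wedge$ and $\vee$. A lattice is join-semidistributive if $x\vee y=x\vee z$ implies $x\vee(y\wedge z)=x\vee y$. $(P,\phi)$-Tamari lattices. Let $P$ be a finite poset with minimum $\hat 0$ and $\phi:\phi(0)=\hat 0<\dots<\phi(r-1)$ a chain in $P$. Put $\mathcal C_k:=\{y\in P\mid y\le\phi(k)\}\times\{k\}$ for $0\le k<r$, and $\mathcal C_P^\phi:=\bigsqcup_{k<r}\mathcal C_k$ (disjoint union of posets: $(x,i)\le(y,j)$ iff $i=j$ and $x\le y$). An order filter (up-closed subset) $F$ of $\mathcal C_P^\phi$ is torclosed if for all $i<j<r$: $(x,i)\in F$ and $(\phi(i+1),j)\in F$ imply $(x,j)\in F$. $\mathrm{Tam}(P,\phi)$ is the lattice of torclosed subsets of $\mathcal C_P^\phi$ ordered by inclusion. *)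

(* Defs.v *)
From HB Require Import structures.
From mathcomp Require Import all_boot all_order all_algebra.

Set Implicit Arguments.
Unset Strict Implicit.
Unset Printing Implicit Defensive.

Import Order.TTheory GRing.Theory.
Local Open Scope ring_scope.

Definition os (n d : nat) :=
  {y : d.-tuple 'I_n | sorted leq [seq val a | a <- y]}.

(* Positions are counted from 0: [ent y i] is the mathematician's y_(i+1).   *)
Definition ent n d (y : os n d) (i : nat) : nat :=
  nth 0%N [seq val a | a <- val y] i.

(* z = y - e_i; the sum avoids truncated subtraction. *)
Definition step n d (i : 'I_d) (y z : os n d) : bool :=
  [forall j : 'I_d, ent y j == (ent z j + (j == i))%N].

Definition interlaced n d (x : os n d.+1) (y : os n d) : bool :=
  [forall i : 'I_d, (ent x i <= ent y i <= ent x i.+1)%N].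

Definition kupisch n (l : n.-tuple nat) : Prop :=
  [/\ forall i, (i < n)%N -> (0 < nth 0 l i)%N,
      nth 0%N l 0 = 1%N
    & forall i, (0 < i < n)%N -> (2 <= nth 0 l i <= (nth 0 l i.-1).+1)%N].

(* y_1 >= y_(d+1) - l_(y_(d+1)) + 1, rearranged because subtraction on nat   *)
(* is truncated.                                                             *)
Definition os_kupisch n d (l : n.-tuple nat) (y : os n d.+1) : bool :=
  (ent y d + 1 <= ent y 0 + nth 0 l (ent y d))%N.

Section OrderedSequences.
Variables n d : nat.

Lemma size_ent (y : os n d) : size [seq val a | a <- val y] = d.
Proof. by rewrite size_map size_tuple. Qed.

Lemma ent_lt (y : os n d) i : (i < d)%N -> (ent y i < n)%N.
Proof.
move=> id; have /mapP[a _] : ent y i \in [seq val a | a <- val y].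
  by rewrite mem_nth ?size_ent.
by move=> ->; apply: ltn_ord.
Qed.

Lemma ent_inj (y z : os n d) : (forall i : 'I_d, ent y i = ent z i) -> y = z.
Proof.
move=> yz; do 2!apply: val_inj; apply: (inj_map val_inj).
apply: (@eq_from_nth _ 0%N) => [|i]; first by rewrite !size_ent.
by rewrite size_ent => id; apply: (yz (Ordinal id)).
Qed.

Lemma os_build (f : nat -> nat) :
  (forall i, (i < d)%N -> (f i < n)%N) ->
  (forall i, (i.+1 < d)%N -> (f i <= f i.+1)%N) ->
  exists y : os n d, forall i : 'I_d, ent y i = f i.
Proof.
move=> fn fS; pose t := [tuple Ordinal (fn i (ltn_ord i)) | i < d].
have tE : [seq val a | a <- t] = mkseq f d.
  apply: (@eq_from_nth _ 0%N) => [|i]; rewrite size_map size_tuple ?size_mkseq//.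
  move=> id; rewrite nth_mkseq// (nth_map (tnth t (Ordinal id))) ?size_tuple//.
  by rewrite -(tnth_nth _ t (Ordinal id)) tnth_mktuple.
have ts : sorted leq [seq val a | a <- t].
  rewrite tE; apply/(sortedP 0%N) => i; rewrite size_mkseq => id.
  by rewrite !nth_mkseq ?fS// (ltn_trans _ id).
exists (exist _ t ts) => i; by rewrite /ent/= tE nth_mkseq.
Qed.

Lemma interlaced_between (x : os n d.+1) (y w z : os n d) :
    interlaced x y -> interlaced x w ->
    (forall i : 'I_d, ent w i <= ent z i <= ent y i)%N ->
  interlaced x z.
Proof.
move=> /forallP xy /forallP xw wzy; apply/forallP => i.
have /andP[_ yx] := xy i; have /andP[xw' _] := xw i; have /andP[wz zy] := wzy i.
by rewrite (leq_trans xw' wz) (leq_trans zy yx).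
Qed.

Lemma step2E (i j : 'I_d) (y z w : os n d) : step i y z -> step j z w ->
  forall k : 'I_d, ent y k = (ent w k + (k == j) + (k == i))%N.
Proof. by move=> /forallP yz /forallP zw k; rewrite (eqP (yz k)) (eqP (zw k)). Qed.

Lemma step_mid (i j : 'I_d) (x : os n d.+1) (y z w : os n d) :
    step i y z -> step j z w ->
  interlaced x y -> interlaced x w -> interlaced x z.
Proof.
move=> /forallP yz /forallP zw xy xw; apply: (interlaced_between xy xw) => k.
by rewrite (eqP (yz k)) (eqP (zw k)) !leq_addr.
Qed.

Lemma step_swap (i j : 'I_d) (x : os n d.+1) (y z w : os n d) :
    i != j -> step i y z -> step j z w -> interlaced x y -> interlaced x w ->
  exists z' : os n d, step j y z'.
Proof.
move=> ij yz zw /forallP xy /forallP xw.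
have yE := step2E yz zw; pose f (k : nat) := (ent y k - (k == j :> nat))%N.
have fE (k : 'I_d) : f k = (ent w k + (k == i))%N.
  by rewrite /f yE addnAC addnK.
have fx (k : 'I_d) : (ent x k <= f k <= ent x k.+1)%N.
  have /andP[xw' _] := xw k; have /andP[_ yx] := xy k.
  by rewrite {1}fE (leq_trans xw') ?leq_addr//= (leq_trans (leq_subr _ _)).
have [|k kd|z' z'E] := @os_build f.
- by move=> k kd; rewrite (leq_ltn_trans (leq_subr _ _))// ent_lt.
- have /andP[_ fk] := fx (Ordinal (ltnW kd)); have /andP[fk' _] := fx (Ordinal kd).
  exact: leq_trans fk fk'.
exists z'; apply/forallP => k; rewrite z'E fE yE; apply/eqP.
by rewrite addnAC.
Qed.

End OrderedSequences.

(* Modules over A_n^d, as representations. The arrow y -> y - e_i is given   *)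
(* by its index i, its ends and a proof of [step i y z]. [mod_zero] is the   *)
(* relation whose other path runs through a sequence that is not in os_n^d.  *)
Record module (K : fieldType) (n d : nat) := Module {
  mod_obj :> os n d -> vectType K;
  mod_map : forall (i : 'I_d) (y z : os n d),
    step i y z -> 'Hom(mod_obj y, mod_obj z);
  mod_comm : forall (i j : 'I_d) (y z z' w : os n d) (yz : step i y z)
      (zw : step j z w) (yz' : step j y z') (z'w : step i z' w), i != j ->
    (mod_map zw \o mod_map yz)%VF = (mod_map z'w \o mod_map yz')%VF;
  mod_zero : forall (i j : 'I_d) (y z w : os n d) (yz : step i y z)
      (zw : step j z w), i != j -> (forall z', ~~ step j y z') ->
    (mod_map zw \o mod_map yz)%VF = 0
}.
Arguments mod_map {K n d} V {i y z} : rename.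
Arguments mod_comm {K n d} V {i j y z z' w} : rename.
Arguments mod_zero {K n d} V {i j y z w} : rename.

Record mor (K : fieldType) n d (V W : module K n d) := Mor {
  mor_at :> forall y, 'Hom(V y, W y);
  mor_comm : forall (i : 'I_d) (y z : os n d) (yz : step i y z),
    (mor_at z \o mod_map V yz)%VF = (mod_map W yz \o mor_at y)%VF
}.

Definition mod_iso (K : fieldType) n d (V W : module K n d) : Prop :=
  exists (f : mor V W) (g : mor W V),
    (forall y, cancel (f y) (g y)) /\ (forall y, cancel (g y) (f y)).

Definition mor_mono (K : fieldType) n d (V W : module K n d) (f : mor V W) :=
  forall y, lker (f y) = 0%VS.

Definition exact_at (K : fieldType) n d (V W X : module K n d)
    (f : mor V W) (g : mor W X) :=
  forall y, limg (f y) = lker (g y).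

Definition mod_is_zero (K : fieldType) n d (V : module K n d) :=
  forall y, \dim {: V y} = 0%N.

Section DirectSums.
Variables (K : fieldType) (n d : nat).

Lemma comp_lfun0l (U V W : vectType K) (f : 'Hom(U, V)) :
  ((0 : 'Hom(V, W)) \o f)%VF = 0.
Proof. by apply/lfunP => u; rewrite comp_lfunE !zero_lfunE. Qed.

Definition mod0_obj (y : os n d) : vectType K := 'rV[K]_0.

Definition mod0 : module K n d.
Proof.
exists mod0_obj (fun i y z yz => 0).
- by move=> *; rewrite !comp_lfun0l.
- by move=> *; rewrite comp_lfun0l.
Defined.

Definition pair_fun (U U' V V' : vectType K) (f : 'Hom(U, U')) (g : 'Hom(V, V'))
  (p : U * V) : U' * V' := (f p.1, g p.2).

Fact pair_fun_linear (U U' V V' : vectType K) (f : 'Hom(U, U')) (g : 'Hom(V, V')) :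
  linear (pair_fun f g).
Proof. by move=> a p q; rewrite /pair_fun !linearP. Qed.

HB.instance Definition _ (U U' V V' : vectType K) (f : 'Hom(U, U'))
    (g : 'Hom(V, V')) := GRing.isLinear.Build K (U * V)%type (U' * V')%type *:%R
  (pair_fun f g) (pair_fun_linear f g).

Definition pair_lfun (U U' V V' : vectType K) (f : 'Hom(U, U')) (g : 'Hom(V, V'))
  : 'Hom((U * V)%type, (U' * V')%type) := linfun (pair_fun f g).

Lemma pair_lfun_comp (U U' U'' V V' V'' : vectType K) (f : 'Hom(U, U'))
    (f' : 'Hom(U', U'')) (g : 'Hom(V, V')) (g' : 'Hom(V', V'')) :
  (pair_lfun f' g' \o pair_lfun f g)%VF = pair_lfun (f' \o f) (g' \o g).
Proof. by apply/lfunP => p; rewrite !(comp_lfunE, lfunE)/= /pair_fun !comp_lfunE. Qed.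

Lemma pair_lfun0 (U U' V V' : vectType K) :
  pair_lfun (0 : 'Hom(U, U')) (0 : 'Hom(V, V')) = 0.
Proof. by apply/lfunP => p; rewrite lfunE/= /pair_fun !zero_lfunE. Qed.

Definition mod_sum_obj (V W : module K n d) (y : os n d) : vectType K :=
  (V y * W y)%type.

Definition mod_sum (V W : module K n d) : module K n d.
Proof.
exists (mod_sum_obj V W) (fun i y z yz => pair_lfun (mod_map V yz) (mod_map W yz)).
- move=> i j y z z' w yz zw yz' z'w ij.
  by rewrite !pair_lfun_comp (mod_comm V yz zw yz' z'w ij) (mod_comm W yz zw yz' z'w ij).
- move=> i j y z w yz zw ij nz.
  by rewrite pair_lfun_comp (mod_zero V yz zw ij nz) (mod_zero W yz zw ij nz) pair_lfun0.
Defined.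

End DirectSums.

Definition mod_bigsum (K : fieldType) n d (s : seq (module K n d)) :
  module K n d := foldr (@mod_sum K n d) (mod0 K n d) s.

Section IntervalModule.
Variables (K : fieldType) (n d : nat) (x : os n d.+1).

(* 'rV[K]_1 on the support of M_x and 'rV[K]_0 outside it. *)
Definition Mx_obj (y : os n d) : vectType K := 'rV[K]_(interlaced x y).

(* [pid_mx 1] is the identity matrix when y and z are in the support, and an *)
(* empty matrix otherwise.                                                   *)
Definition Mx_map (y z : os n d) : 'Hom(Mx_obj y, Mx_obj z) :=
  linfun (mulmxr (pid_mx 1 : 'M[K]_(interlaced x y, interlaced x z))).

Lemma Mx_mapE y z (v : Mx_obj y) :
  Mx_map y z v = (v *m pid_mx 1 : 'rV_(interlaced x z)).
Proof. by rewrite lfunE. Qed.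

Lemma Mx_map_comp y z w :
    (interlaced x y -> interlaced x w -> interlaced x z) ->
  (Mx_map z w \o Mx_map y z)%VF = Mx_map y w.
Proof.
move=> H; apply/lfunP => v; rewrite comp_lfunE !Mx_mapE -mulmxA mul_pid_mx.
congr (_ *m _); apply/matrixP => a b.
have ay : interlaced x y by case: (interlaced x y) a => // -[].
have bw : interlaced x w by case: (interlaced x w) b => // -[].
by rewrite (H ay bw) minnn.
Qed.

Lemma Mx_map_zero y w : ~~ (interlaced x y && interlaced x w) -> Mx_map y w = 0.
Proof.
move=> H; apply/lfunP => v; rewrite Mx_mapE zero_lfunE.
apply/matrixP => a b; rewrite !mxE big1// => k _.
have ky : interlaced x y by case: (interlaced x y) k => // -[].
have bw : interlaced x w by case: (interlaced x w) b => // -[].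
by rewrite ky bw in H.
Qed.

Definition Mx : module K n d.
Proof.
exists Mx_obj (fun i y z _ => Mx_map y z).
- move=> i j y z z' w yz zw yz' z'w ij; rewrite !Mx_map_comp//.
  + exact: step_mid yz' z'w.
  + exact: step_mid yz zw.
- move=> i j y z w yz zw ij nz; rewrite Mx_map_comp; last exact: step_mid yz zw.
  apply: Mx_map_zero; apply/negP => /andP[xy xw].
  have [z' yz'] := step_swap ij yz zw xy xw.
  by have := nz z'; rewrite yz'.
Defined.

End IntervalModule.

Definition add_Mx (K : fieldType) n d (X : pred (os n d.+1)) (V : module K n d) :
  Prop := exists2 s : seq (os n d.+1), all X s
    & mod_iso V (mod_bigsum [seq Mx K x | x <- s]).

Definition auslander_M (K : fieldType) n d : module K n d -> Prop :=
  add_Mx predT.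

Inductive qpath n d : os n d -> os n d -> Type :=
| qnil y : qpath y y
| qcons (i : 'I_d) y z w : step i y z -> qpath z w -> qpath y w.

Fixpoint path_act (K : fieldType) n d (V : module K n d) y z (p : qpath y z) :
    'Hom(V y, V z) :=
  match p in qpath y z return 'Hom(V y, V z) with
  | qnil y => \1%VF
  | qcons i y z w yz q => (path_act V q \o mod_map V yz)%VF
  end.

Definition comb_act (K : fieldType) n d (V : module K n d) y z
    (c : seq (K * qpath y z)) : 'Hom(V y, V z) :=
  \sum_(t <- c) t.1 *: path_act V t.2.

(* Modules over the quotient A_l^d are the A_n^d-modules on which the        *)
(* annihilator of the direct sum of the M_x, x in os_l^(d+1), acts as zero.  *)
(* That annihilator is a two-sided ideal, hence it is spanned by its         *)
(* elements e_z a e_y, the linear combinations of paths from y to z; and     *)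
(* such an element kills a direct sum iff it kills every summand.            *)
Definition nakayama_module (K : fieldType) n d (l : n.-tuple nat)
    (V : module K n d) : Prop :=
  forall (y z : os n d) (c : seq (K * qpath y z)),
    (forall x : os n d.+1, os_kupisch l x -> comb_act (Mx K x) c = 0) ->
    comb_act V c = 0.

Definition nakayama_M (K : fieldType) n d (l : n.-tuple nat)
    (V : module K n d) : Prop :=
  nakayama_module l V /\ add_Mx (os_kupisch l) V.

(* The terms V_1, ..., V_d are [V 0], ..., [V d.-1]. They are continued by   *)
(* zero modules, so that exactness at [V k] for all k includes surjectivity  *)
(* of V_(d-1) -> V_d, and likewise after applying Hom(U, -).                 *)
Definition torsion_seq (K : fieldType) n d (M U : module K n d -> Prop)
    (X : module K n d) : Prop :=
  exists (UX : module K n d) (V : nat -> module K n d)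
      (f : mor UX X) (g : mor X (V 0%N)) (h : forall k, mor (V k) (V k.+1)),
    [/\ M UX, U UX, (forall k, M (V k)) & (forall k, (d <= k)%N -> mod_is_zero (V k))]
    /\ [/\ mor_mono f, exact_at f g, exact_at g (h 0%N)
         & forall k, exact_at (h k) (h k.+1)]
    /\ (forall T, U T ->
         (forall t : mor T (V 0%N),
            (forall y, (h 0%N y \o t y)%VF = 0) -> forall y, t y = 0)
         /\ (forall k (t : mor T (V k.+1)),
            (forall y, (h k.+1 y \o t y)%VF = 0) ->
            exists s : mor T (V k), forall y, t y = (h k y \o s y)%VF)).

Record torsion_class (K : fieldType) n d (M : module K n d -> Prop) :=
    TorsionClass {
  tors_in :> module K n d -> Prop;
  tors_sub : forall V, tors_in V -> M V;
  tors_iso : forall V W, mod_iso V W -> tors_in V -> tors_in W;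
  tors_0 : tors_in (mod0 K n d);
  tors_sum : forall V W, tors_in V -> tors_in W -> tors_in (mod_sum V W);
  tors_summand : forall V W, tors_in (mod_sum V W) -> tors_in V;
  tors_seq : forall X, M X -> torsion_seq M tors_in X
}.

Definition lattice_iso d1 (L1 : latticeType d1) d2 (L2 : latticeType d2) : Prop :=
  exists2 f : L1 -> L2, bijective f & {mono f : x y / (x <= y)%O}.

(* The poset of d-torsion classes of M, ordered by inclusion, is isomorphic  *)
(* to L; in particular it is a finite lattice.                               *)
Definition torsion_lattice (K : fieldType) n d (M : module K n d -> Prop)
    disp (L : finLatticeType disp) : Prop :=
  exists f : torsion_class M -> L,
    (forall U U' : torsion_class M,
       (forall V, U V -> U' V) <-> (f U <= f U')%O)
    /\ (forall a, exists U, f U = a).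

Record congruence disp (L : latticeType disp) := Congruence {
  cong_rel :> rel L;
  cong_refl : reflexive cong_rel;
  cong_sym : symmetric cong_rel;
  cong_trans : transitive cong_rel;
  cong_meet : forall x x' y y', cong_rel x x' -> cong_rel y y' ->
    cong_rel (x `&` y)%O (x' `&` y')%O;
  cong_join : forall x x' y y', cong_rel x x' -> cong_rel y y' ->
    cong_rel (x `|` y)%O (x' `|` y')%O
}.

Section LatticeQuotient.
Local Open Scope quotient_scope.
Variables (disp : Order.disp_t) (L : finLatticeType disp) (c : congruence L).

Definition cong_equiv : equiv_rel L :=
  EquivRel c (cong_refl c) (cong_sym c) (@cong_trans _ _ c).

Definition lquot := {eq_quot cong_equiv}.

HB.instance Definition _ := Choice.on lquot.
HB.instance Definition _ := EqQuotient.on lquot.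
HB.instance Definition _ : isCountable lquot := CanIsCountable (@reprK _ lquot).
HB.instance Definition _ : isFinite lquot := CanIsFinite (@reprK _ lquot).

Definition lquot_meet (a b : lquot) : lquot := \pi_lquot (repr a `&` repr b)%O.
Definition lquot_join (a b : lquot) : lquot := \pi_lquot (repr a `|` repr b)%O.
Definition lquot_le (a b : lquot) : bool := lquot_meet a b == a.

Lemma cong_repr x : c (repr (\pi_lquot x)) x.
Proof.
by rewrite -[c _ _]/(cong_equiv _ _) -(@pi_eq_quot _ _ lquot) reprK.
Qed.

Lemma lquot_meetE x y :
  lquot_meet (\pi_lquot x) (\pi_lquot y) = \pi_lquot (x `&` y)%O.
Proof.
apply/eqP; rewrite pi_eq_quot; apply: (cong_meet (c := c)); exact: cong_repr.
Qed.

Lemma lquot_joinE x y :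
  lquot_join (\pi_lquot x) (\pi_lquot y) = \pi_lquot (x `|` y)%O.
Proof.
apply/eqP; rewrite pi_eq_quot; apply: (cong_join (c := c)); exact: cong_repr.
Qed.

Lemma lquotP (a : lquot) : exists x, a = \pi_lquot x.
Proof. by exists (repr a); rewrite reprK. Qed.

Fact lquot_meetC : commutative lquot_meet.
Proof.
move=> a b; case: (lquotP a) (lquotP b) => x -> [y ->].
by rewrite !lquot_meetE meetC.
Qed.
Fact lquot_joinC : commutative lquot_join.
Proof.
move=> a b; case: (lquotP a) (lquotP b) => x -> [y ->].
by rewrite !lquot_joinE joinC.
Qed.
Fact lquot_meetA : associative lquot_meet.
Proof.
move=> a b e; case: (lquotP a) (lquotP b) (lquotP e) => x -> [y ->] [z ->].
by rewrite (lquot_meetE y z) (lquot_meetE x y) !lquot_meetE meetA.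
Qed.
Fact lquot_joinA : associative lquot_join.
Proof.
move=> a b e; case: (lquotP a) (lquotP b) (lquotP e) => x -> [y ->] [z ->].
by rewrite (lquot_joinE y z) (lquot_joinE x y) !lquot_joinE joinA.
Qed.
Fact lquot_joinKI : forall b a, lquot_meet a (lquot_join a b) = a.
Proof.
move=> b a; case: (lquotP a) (lquotP b) => x -> [y ->].
by rewrite (lquot_joinE x y) (lquot_meetE x _) joinKI.
Qed.
Fact lquot_meetKU : forall b a, lquot_join a (lquot_meet a b) = a.
Proof.
move=> b a; case: (lquotP a) (lquotP b) => x -> [y ->].
by rewrite (lquot_meetE x y) (lquot_joinE x _) meetKU.
Qed.

Fact lquot_le_refl : reflexive lquot_le.
Proof.
by move=> a; case: (lquotP a) => x ->; rewrite /lquot_le lquot_meetE meetxx.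
Qed.
Fact lquot_le_anti : antisymmetric lquot_le.
Proof. by move=> a b /andP[/eqP ab /eqP ba]; rewrite -ab lquot_meetC. Qed.
Fact lquot_le_trans : transitive lquot_le.
Proof.
move=> b a e /eqP ab /eqP be; apply/eqP.
by rewrite -ab -lquot_meetA be.
Qed.

HB.instance Definition _ := Order.Le_isPOrder.Build disp lquot
  lquot_le_refl lquot_le_anti lquot_le_trans.
HB.instance Definition _ := Order.POrder_isLattice.Build disp lquot
  lquot_meetC lquot_joinC lquot_meetA lquot_joinA lquot_joinKI lquot_meetKU
  (fun _ _ => erefl).

End LatticeQuotient.

Definition lattice_quotient d1 (L1 : finLatticeType d1) d2 (L2 : finLatticeType d2)
  : Prop := exists c : congruence L1, lattice_iso (lquot c) L2.

Definition join_semidistributive disp (L : latticeType disp) : Prop :=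
  forall x y z : L, (x `|` y = x `|` z -> x `|` (y `&` z) = x `|` y)%O.

Definition lattice_property := forall disp, finLatticeType disp -> Prop.

Definition iso_invariant (Q : lattice_property) : Prop :=
  forall d1 (L1 : finLatticeType d1) d2 (L2 : finLatticeType d2),
    lattice_iso L1 L2 -> Q d1 L1 -> Q d2 L2.

Definition quotient_preserved (Q : lattice_property) : Prop :=
  forall disp (L : finLatticeType disp) (c : congruence L),
    Q disp L -> Q disp (lquot c).

(* The chain phi(0) < ... < phi(r - 1) is the sequence of its elements, so   *)
(* r = size phi, and r > 0 because phi(0) exists.                            *)
Record bot_chain dP (P : finBPOrderType dP) := BotChain {
  chain_seq :> seq P;
  chain_head : ohead chain_seq = Some \bot%O;
  chain_lt : sorted <%O chain_seq
}.

Definition chain_at dP (P : finBPOrderType dP) (phi : bot_chain P) (k : nat) : P :=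
  nth \bot%O phi k.

Section Tamari.
Variables (dP : Order.disp_t) (P : finBPOrderType dP) (phi : bot_chain P).

Local Notation I := 'I_(size phi).

(* The elements (y, k) of C_P^phi, inside the product of P and {0, ..., r-1} *)
Definition tam_carrier : {set P * I} := [set p : P * I | (p.1 <= chain_at phi p.2)%O].

Definition torclosed_filter (F : {set P * I}) : bool :=
  [&& F \subset tam_carrier,
      [forall x : P, forall y : P, forall k : I,
        [&& (x, k) \in F, (x <= y)%O & (y, k) \in tam_carrier] ==> ((y, k) \in F)]
    & [forall x : P, forall i : I, forall j : I,
        [&& (i < j)%N, (x, i) \in F & (chain_at phi i.+1, j) \in F]
          ==> ((x, j) \in F)]].

Definition Tam := {F : {set P * I} | torclosed_filter F}.

HB.instance Definition _ := Finite.on Tam.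

Definition tam_le (F G : Tam) : bool := val F \subset val G.

Fact tam_le_refl : reflexive tam_le.
Proof. by move=> F; apply: subxx. Qed.
Fact tam_le_anti : antisymmetric tam_le.
Proof. by move=> F G FG; apply/val_inj/eqP; rewrite eqEsubset. Qed.
Fact tam_le_trans : transitive tam_le.
Proof. by move=> G F H; apply: subset_trans. Qed.

Fact tam_disp : Order.disp_t. Proof. exact: Order.Disp tt tt. Qed.

HB.instance Definition _ := Order.Le_isPOrder.Build tam_disp Tam
  tam_le_refl tam_le_anti tam_le_trans.

Lemma torclosed_filterP (F : {set P * I}) :
  reflect [/\ F \subset tam_carrier,
    forall x y k, (x, k) \in F -> (x <= y)%O -> (y, k) \in tam_carrier ->
      (y, k) \in F
    & forall x (i j : I), (i < j)%N -> (x, i) \in F ->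
      (chain_at phi i.+1, j) \in F -> (x, j) \in F] (torclosed_filter F).
Proof.
apply: (iffP and3P) => -[sF uF cF]; split=> //.
- move=> x y k xk xy yk; have /forallP/(_ x)/forallP/(_ y)/forallP/(_ k) := uF.
  by rewrite xk xy yk.
- move=> x i j ij xi ij'; have /forallP/(_ x)/forallP/(_ i)/forallP/(_ j) := cF.
  by rewrite ij xi ij'.
- apply/forallP => x; apply/forallP => y; apply/forallP => k.
  by apply/implyP => /and3P[]; apply: uF.
- apply/forallP => x; apply/forallP => i; apply/forallP => j.
  by apply/implyP => /and3P[]; apply: cF.
Qed.

Lemma torclosed_carrier : torclosed_filter tam_carrier.
Proof.
apply/torclosed_filterP; split=> // x i j ij; rewrite !inE/= => xi _.
apply: le_trans xi _; apply/ltW.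
by apply: (sorted_ltn_nth lt_trans \bot%O (chain_lt phi)); rewrite ?inE.
Qed.

Lemma torclosed_cap (A : pred {set P * I}) :
  torclosed_filter (tam_carrier :&: \bigcap_(H | torclosed_filter H && A H) H).
Proof.
have [_ _ cC] := torclosed_filterP _ torclosed_carrier.
apply/torclosed_filterP; split; first exact: subsetIl.
- move=> x y k /setIP[xC /bigcapP xk] xy yk; apply/setIP; split=> //.
  apply/bigcapP => H HA; have [_ uH _] := torclosed_filterP _ (andP HA).1.
  exact: uH (xk _ HA) xy yk.
- move=> x i j ij /setIP[xC /bigcapP xi] /setIP[iC /bigcapP ci].
  apply/setIP; split; first exact: cC ij xC iC.
  apply/bigcapP => H HA; have [_ _ cH] := torclosed_filterP _ (andP HA).1.
  exact: cH ij (xi _ HA) (ci _ HA).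
Qed.

Definition tam_hull (A : {set P * I}) : Tam :=
  exist torclosed_filter _ (torclosed_cap (fun H => A \subset H)).

Lemma tam_capP (F G : Tam) : torclosed_filter (val F :&: val G).
Proof.
have [sF uF cF] := torclosed_filterP _ (valP F).
have [sG uG cG] := torclosed_filterP _ (valP G).
apply/torclosed_filterP; split.
- exact: subset_trans (subsetIl _ _) sF.
- move=> x y k /setIP[xF xG] xy yk; apply/setIP.
  by split; [exact: uF xF xy yk | exact: uG xG xy yk].
- move=> x i j ij /setIP[xF xG] /setIP[iF iG]; apply/setIP.
  by split; [exact: cF ij xF iF | exact: cG ij xG iG].
Qed.

Definition tam_meet (F G : Tam) : Tam :=
  exist torclosed_filter _ (tam_capP F G).
Definition tam_join (F G : Tam) : Tam := tam_hull (val F :|: val G).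

Fact tam_meetP (F G H : Tam) : (F <= tam_meet G H)%O = (F <= G)%O && (F <= H)%O.
Proof. exact: subsetI. Qed.

Fact tam_joinP (F G H : Tam) : (tam_join F G <= H)%O = (F <= H)%O && (G <= H)%O.
Proof.
have sC (E : Tam) : val E \subset tam_carrier.
  by have [] := torclosed_filterP _ (valP E).
have le_hull (A : {set P * I}) : A \subset tam_carrier -> A \subset val (tam_hull A).
  move=> sAC; rewrite subsetI sAC; apply/bigcapsP => E /andP[_ ->] //.
rewrite -[RHS]subUset; apply/idP/idP => [|FGH].
  by apply: subset_trans; apply: le_hull; rewrite subUset !sC.
apply: subset_trans (subsetIr _ _) _.
by apply: bigcap_inf; rewrite (valP H) FGH.
Qed.

HB.instance Definition _ := Order.POrder_MeetJoin_isLattice.Build tam_disp Tam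
  tam_meetP tam_joinP.

End Tamari.

(* Main.v *)
(* Write M_x -> M_y for a nonzero morphism; it exists iff x_1 <= y_1 <= x_2 <= y_2 <= ... <= x_(d+1) <= y_(d+1),
   and it is then unique up to a scalar. Let X be os_n^(d+1) or os_l^(d+1).

   For a_0 <= ... <= a_(d+1) put V_t := (a_0, ..., a_(t-1), a_(t+1) + 1, ..., a_(d+1) + 1). The modules M_(V_t)
   form an exact sequence 0 -> M_(V_(d+1)) -> ... -> M_(V_0) -> 0, and Hom(M_u, -) is exact on it unless
   M_u -> M_(V_0) and u_1 > a_0. Hence a subset F of X spans a d-torsion class iff it is closed under increasing
   all entries but the last, and (x, k), (k+1, ..., k+1, j) in F and (x, j) in X imply (x, j) in F. That these
   conditions are necessary is seen by comparing an arbitrary torsion sequence of M_(x,j) with the projective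
   resolution of M_u, which is the sequence above with a_0 = 0.

   For X = os_n^(d+1) the sets F are the torclosed filters of Tam(P, phi), with P = os_n^d ordered
   componentwise and phi(k) = (k, ..., k). Restricting a torclosed filter to os_l^(d+1) is onto the closed sets
   there, and it is compatible with joins because a closed subset of os_l^(d+1) is the restriction of a largest
   torclosed filter. So L_l is the quotient of Tam(P, phi) by the congruence of having the same
   restriction; and join-semidistributivity passes from Tam(P, phi) to finite quotients. *)
Require Import Defs.
From HB Require Import structures.
From mathcomp Require Import all_boot all_order all_algebra.
From mathcomp Require Import zify boolp.

Set Implicit Arguments.
Unset Strict Implicit.
Unset Printing Implicit Defensive.

Import Order.TTheory GRing.Theory.
Local Open Scope ring_scope.
Local Obligation Tactic := idtac.

(** * Morphisms of modules *)

Section ThinSpaces.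
Variable K : fieldType.

(** The basis vector of ['rV_1] when [a] holds and the only vector of ['rV_0] otherwise, so that one
    formula serves vertices inside and outside a support. *)
Definition thin1 (a : bool) : 'rV[K]_a := const_mx 1.
Definition cmap (a b : bool) : 'Hom('rV[K]_a, 'rV[K]_b) :=
  linfun (mulmxr (pid_mx 1 : 'M[K]_(a, b))).

Lemma thin1P (a : bool) (v : 'rV[K]_a) : exists c, v = c *: thin1 a.
Proof.
case: a v => v; last by exists 0; apply/rowP => -[].
by exists (v 0 0); apply/rowP => i; rewrite !mxE mulr1 (ord1 i).
Qed.

Lemma thin1_eq0 (a : bool) : (thin1 a == 0) = ~~ a.
Proof.
case: a; last by apply/eqP/rowP => -[].
by apply/negbTE/eqP => /rowP/(_ 0); rewrite !mxE; apply/eqP/oner_neq0.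
Qed.

Lemma thin1_0 (a : bool) : ~~ a -> thin1 a = 0.
Proof. by rewrite -thin1_eq0 => /eqP. Qed.

Lemma cmap1 (a b : bool) : cmap a b (thin1 a) = a%:R *: thin1 b.
Proof.
rewrite lfunE /=; apply/rowP => i; rewrite !mxE.
case: a; last by rewrite big_ord0 mul0r.
rewrite big_ord_recl big_ord0 !mxE addr0 !mul1r.
by case: b i => // -[[]].
Qed.

End ThinSpaces.

Lemma lfunZ (K : fieldType) (U V : vectType K) (f : 'Hom(U, V)) a v :
  f (a *: v) = a *: f v.
Proof. exact: linearZZ. Qed.

Lemma lfunD (K : fieldType) (U V : vectType K) (f : 'Hom(U, V)) u v :
  f (u + v) = f u + f v.
Proof. exact: linearD. Qed.

Lemma lfunB (K : fieldType) (U V : vectType K) (f : 'Hom(U, V)) u v :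
  f (u - v) = f u - f v.
Proof. exact: linearB. Qed.

Lemma lfun0 (K : fieldType) (U V : vectType K) (f : 'Hom(U, V)) : f 0 = 0.
Proof. exact: linear0. Qed.

Section Morphisms.
Variables (K : fieldType) (n d : nat).
Implicit Types V W X Y : module K n d.

Lemma mor_nat V W (f : mor V W) i y z (yz : step i y z) v :
  f z (mod_map V yz v) = mod_map W yz (f y v).
Proof. by have /lfunP/(_ v) := mor_comm f yz; rewrite !comp_lfunE. Qed.

Program Definition mor_id V : mor V V := @Mor K n d V V (fun y => \1%VF) _.
Next Obligation. by move=> V i y z yz; rewrite comp_lfun1l comp_lfun1r. Qed.

Program Definition mor_comp V W X (g : mor W X) (f : mor V W) : mor V X :=
  @Mor K n d V X (fun y => g y \o f y)%VF _.
Next Obligation.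
move=> V W X g f i y z yz; apply/lfunP => v.
by rewrite !comp_lfunE !mor_nat.
Qed.

Program Definition mor0 V W : mor V W := @Mor K n d V W (fun y => 0) _.
Next Obligation. by move=> V W i y z yz; rewrite comp_lfun0l comp_lfun0r. Qed.

Program Definition mor_add V W (f g : mor V W) : mor V W :=
  @Mor K n d V W (fun y => f y + g y) _.
Next Obligation.
move=> V W f g i y z yz; apply/lfunP => v.
by rewrite !(comp_lfunE, add_lfunE) !mor_nat linearD.
Qed.

Program Definition mor_scale V W (c : K) (f : mor V W) : mor V W :=
  @Mor K n d V W (fun y => c *: f y) _.
Next Obligation.
move=> V W c f i y z yz; apply/lfunP => v.
by rewrite !(comp_lfunE, scale_lfunE) !mor_nat linearZ.
Qed.

Lemma mor_idE V y v : mor_id V y v = v. Proof. exact: id_lfunE. Qed.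
Lemma mor_compE V W X (g : mor W X) (f : mor V W) y v :
  mor_comp g f y v = g y (f y v).
Proof. exact: comp_lfunE. Qed.
Lemma mor0E V W y v : mor0 V W y v = 0. Proof. exact: zero_lfunE. Qed.
Lemma mor_addE V W (f g : mor V W) y v : mor_add f g y v = f y v + g y v.
Proof. exact: add_lfunE. Qed.
Lemma mor_scaleE V W c (f : mor V W) y v : mor_scale c f y v = c *: f y v.
Proof. exact: scale_lfunE. Qed.

Definition morE := (mor_idE, mor_compE, mor0E, mor_addE, mor_scaleE).

Section SumMaps.
Variables V W : module K n d.

Program Definition mor_fst : mor (mod_sum V W) V :=
  @Mor K n d (mod_sum V W) V (fun y => linfun (@fst (V y) (W y))) _.
Next Obligation.
by move=> i y z yz; apply/lfunP => v; rewrite !(comp_lfunE, lfunE).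
Qed.
Program Definition mor_snd : mor (mod_sum V W) W :=
  @Mor K n d (mod_sum V W) W (fun y => linfun (@snd (V y) (W y))) _.
Next Obligation.
by move=> i y z yz; apply/lfunP => v; rewrite !(comp_lfunE, lfunE).
Qed.

Lemma mor_fstE y (v : mod_sum V W y) : mor_fst y v = v.1.
Proof. exact: lfunE. Qed.
Lemma mor_sndE y (v : mod_sum V W y) : mor_snd y v = v.2.
Proof. exact: lfunE. Qed.

Definition pair_at X (f : mor X V) (g : mor X W) y (v : X y) : mod_sum V W y :=
  (f y v, g y v).
Fact pair_at_linear X (f : mor X V) (g : mor X W) y : linear (@pair_at X f g y).
Proof. by move=> a u v; rewrite /pair_at !linearP. Qed.
HB.instance Definition _ X (f : mor X V) (g : mor X W) y :=
  GRing.isLinear.Build K (X y) (mod_sum V W y) *:%R (@pair_at X f g y)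
    (@pair_at_linear X f g y).

Program Definition mor_pair X (f : mor X V) (g : mor X W) : mor X (mod_sum V W) :=
  @Mor K n d X (mod_sum V W) (fun y => linfun (@pair_at X f g y)) _.
Next Obligation.
move=> X f g i y z yz; apply/lfunP => v.
by rewrite !(comp_lfunE, lfunE) /= /pair_at /pair_fun !mor_nat.
Qed.

Lemma mor_pairE X (f : mor X V) (g : mor X W) y v :
  mor_pair f g y v = (f y v, g y v).
Proof. exact: lfunE. Qed.

Definition mor_inl := mor_pair (mor_id V) (mor0 V W).
Definition mor_inr := mor_pair (mor0 W V) (mor_id W).

Lemma mor_inlE y v : mor_inl y v = (v, 0).
Proof. by rewrite mor_pairE mor_idE mor0E. Qed.
Lemma mor_inrE y v : mor_inr y v = (0, v).
Proof. by rewrite mor_pairE mor_idE mor0E. Qed.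

End SumMaps.

Definition mor_copair V W X (f : mor V X) (g : mor W X) : mor (mod_sum V W) X :=
  mor_add (mor_comp f (mor_fst V W)) (mor_comp g (mor_snd V W)).

Lemma mor_copairE V W X (f : mor V X) (g : mor W X) y v :
  mor_copair f g y v = f y v.1 + g y v.2.
Proof. by rewrite !morE mor_fstE mor_sndE. Qed.

Definition mor_sum V V' W W' (f : mor V V') (g : mor W W') :
    mor (mod_sum V W) (mod_sum V' W') :=
  mor_pair (mor_comp f (mor_fst V W)) (mor_comp g (mor_snd V W)).

Lemma mor_sumE V V' W W' (f : mor V V') (g : mor W W') y v :
  mor_sum f g y v = (f y v.1, g y v.2).
Proof. by rewrite mor_pairE !mor_compE mor_fstE mor_sndE. Qed.

Lemma mod_iso_refl V : mod_iso V V.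
Proof. by exists (mor_id V), (mor_id V); split=> y v; rewrite !mor_idE. Qed.

Lemma mod_iso_sym V W : mod_iso V W -> mod_iso W V.
Proof. by case=> f [g [fg gf]]; exists g, f. Qed.

Lemma mod_iso_trans V W X : mod_iso V W -> mod_iso W X -> mod_iso V X.
Proof.
case=> f [g [fg gf]] [f' [g' [fg' gf']]].
exists (mor_comp f' f), (mor_comp g g').
by split=> y v; rewrite !mor_compE ?fg' ?fg ?gf ?gf'.
Qed.

Lemma mod_iso_sum V V' W W' :
  mod_iso V V' -> mod_iso W W' -> mod_iso (mod_sum V W) (mod_sum V' W').
Proof.
case=> f [g [fg gf]] [f' [g' [fg' gf']]].
exists (mor_sum f f'), (mor_sum g g').
by split=> y -[v w]; rewrite !mor_sumE ?fg ?fg' ?gf ?gf'.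
Qed.

Lemma mod_zeroP V : mod_is_zero V <-> forall y (v : V y), v = 0.
Proof.
split=> [V0 y v|V0 y].
  have /eqP := V0 y; rewrite dimv_eq0 => /eqP X0.
  by apply/eqP; rewrite -memv0 -X0 memvf.
by apply/eqP; rewrite dimv_eq0; apply/eqP/vspaceP => v; rewrite (V0 y v) !mem0v.
Qed.

Lemma mod_iso_zero V W : mod_is_zero V -> mod_is_zero W -> mod_iso V W.
Proof.
move=> /mod_zeroP V0 /mod_zeroP W0; exists (mor0 V W), (mor0 W V).
by split=> y v; rewrite !mor0E; apply/esym; [apply: V0|apply: W0].
Qed.

Lemma mod0_zero : mod_is_zero (mod0 K n d).
Proof. by apply/mod_zeroP => y v; apply/rowP => -[]. Qed.

Lemma mor_monoP V W (f : mor V W) :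
  mor_mono f <-> forall y v, f y v = 0 -> v = 0.
Proof.
split=> [f0 y v fv|f0 y]; first by apply/eqP; rewrite -memv0 -(f0 y) memv_ker fv.
apply/vspaceP => v; rewrite memv_ker memv0.
by apply/eqP/eqP => [/f0 //|->]; rewrite linear0.
Qed.

Lemma exact_atP V W X (f : mor V W) (g : mor W X) :
  exact_at f g <->
  (forall y v, g y (f y v) = 0) /\ (forall y w, g y w = 0 -> exists v, w = f y v).
Proof.
split=> [fg|[gf0 fg] y].
  split=> y v; first by apply/eqP; rewrite -memv_ker -fg memv_img ?memvf.
  move/eqP; rewrite -memv_ker -fg => /memv_imgP [u _ ->]; by exists u.
apply/vspaceP => w; apply/memv_imgP/idP => [[v _ ->]|]; rewrite memv_ker ?gf0//.
by move/eqP => /fg [v ->]; exists v; rewrite ?memvf.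
Qed.

Lemma path_nilE V y v : path_act V (qnil y) v = v.
Proof. exact: id_lfunE. Qed.

Lemma path_consE V i y z w (yz : step i y z) (p : qpath z w) v :
  path_act V (qcons yz p) v = path_act V p (mod_map V yz v).
Proof. exact: comp_lfunE. Qed.

Lemma path_nat V W (f : mor V W) y z (p : qpath y z) v :
  f z (path_act V p v) = path_act W p (f y v).
Proof.
elim: p v => [x|i x x' x'' xx' p IH] v; first by rewrite !path_nilE.
by rewrite !path_consE IH mor_nat.
Qed.

End Morphisms.

(** * The modules M_x and their morphisms *)

Section Sequences.
Variables n d : nat.
Implicit Types y z : os n d.

Lemma ent_le y i j : (i <= j)%N -> (j < d)%N -> (ent y i <= ent y j)%N.
Proof.
move=> ij jd; apply: (sorted_leq_nth leq_trans leqnn 0%N (valP y)) => //;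
by rewrite inE size_ent // (leq_ltn_trans ij).
Qed.

Lemma entP y z : (forall i, (i < d)%N -> ent y i = ent z i) -> y = z.
Proof. by move=> yz; apply: ent_inj => i; apply: yz. Qed.

Lemma interlacedP (x : os n d.+1) y :
  reflect (forall i, (i < d)%N -> (ent x i <= ent y i <= ent x i.+1)%N)
          (interlaced x y).
Proof.
apply: (iffP forallP) => [H i id|H i]; last exact: H.
exact: (H (Ordinal id)).
Qed.

Lemma stepP (i : 'I_d) y z :
  reflect (forall j, (j < d)%N -> ent y j = (ent z j + (j == i :> nat))%N)
          (step i y z).
Proof.
apply: (iffP forallP) => [H j jd|H j]; last by rewrite H.
by rewrite (eqP (H (Ordinal jd))).
Qed.

Lemma interlaced_build (x : os n d.+1) (f : nat -> nat) :
  (forall i, (i < d)%N -> (ent x i <= f i <= ent x i.+1)%N) ->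
  exists2 y : os n d, interlaced x y & forall i, (i < d)%N -> ent y i = f i.
Proof.
move=> xf; have [i id|i id|y yE] := @os_build n d f.
- have /andP[_ /leq_ltn_trans] := xf _ id; apply; exact: ent_lt.
- have /andP[_ fx] := xf i (ltnW id); have /andP[xf' _] := xf i.+1 id.
  exact: leq_trans fx xf'.
have yE' i : (i < d)%N -> ent y i = f i by move=> id; rewrite -(yE (Ordinal id)).
by exists y => //; apply/interlacedP => i id; rewrite yE' // xf.
Qed.

Lemma path_le y z : qpath y z -> forall i, (i < d)%N -> (ent z i <= ent y i)%N.
Proof.
elim=> [//|i {}y w {}z /stepP yw _ IH j jd].
by rewrite yw //; apply: leq_trans (IH j jd) (leq_addr _ _).
Qed.

(** Induction on the sum of the entries of [y]. The first entry at which [y] exceeds [z] can be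
    lowered by 1: its predecessor already agrees with [z], so the sequence stays non-decreasing. *)
Lemma path_exists y z :
  (forall i, (i < d)%N -> (ent z i <= ent y i)%N) -> exists p : qpath y z, True.
Proof.
elim: (\sum_(i < d) ent y i)%N {-2}y (leqnn (\sum_(i < d) ent y i)) => [|N IH] {}y yN zy.
  suff -> : y = z by exists (qnil z).
  apply: entP => i id; have := zy i id.
  suff -> : ent y i = 0%N by case: (ent z i).
  apply/eqP; rewrite -leqn0; apply: leq_trans yN.
  by rewrite (bigD1 (Ordinal id)) //= leq_addr.
have [yz|] := boolP [forall i : 'I_d, ent y i == ent z i].
  by have -> : y = z by [apply: ent_inj => i; apply/eqP/(forallP yz)]; exists (qnil z).
rewrite negb_forall => /existsP [i0 i0P].
have exi : exists i, (i < d)%N && (ent z i < ent y i)%N.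
  by exists i0; rewrite ltn_ord ltn_neqAle eq_sym i0P zy.
case: (ex_minnP exi) => i /andP[id zyi] imin.
have eqi j : (j < i)%N -> ent y j = ent z j.
  move=> ji; apply/eqP; rewrite eqn_leq zy ?(ltn_trans ji) // andbT leqNgt.
  by apply/negP => zyj; have := imin j; rewrite (ltn_trans ji id) zyj leqNgt ji => /(_ isT).
have [j jd|j jd|w wE] := @os_build n d (fun j => ent y j - (j == i))%N.
- by rewrite (leq_ltn_trans (leq_subr _ _)) ?ent_lt.
- have := ent_le y (leqnSn j) jd; case: (j.+1 =P i) => [ji|_]; last by lia.
  have := eqi j; have := ent_le z (leqnSn j) jd; rewrite ji => zji /(_ _) yzj.
  have := yzj (leqnn _); lia.
have wE' j : (j < d)%N -> ent w j = (ent y j - (j == i))%N.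
  by move=> jd; rewrite -(wE (Ordinal jd)).
have yw : step (Ordinal id) y w.
  apply/stepP => j jd; rewrite wE' //=; case: eqP => [->|_]; last by lia.
  by move: zyi; lia.
have [||p _] := IH w; last by exists (qcons yw p).
- rewrite -ltnS; apply: leq_trans yN.
  rewrite (bigD1 (Ordinal id)) //= [X in (_ < X)%N](bigD1 (Ordinal id)) //=.
  rewrite wE' // eqxx -addSn leq_add //; first by lia.
  by apply: leq_sum => j _; rewrite wE // leq_subr.
- by move=> j jd; rewrite wE' //; case: eqP => [->|_]; rewrite ?subn0 ?zy //; lia.
Qed.

Definition dpath y z (h : forall i, (i < d)%N -> (ent z i <= ent y i)%N) : qpath y z :=
  sval (cid (path_exists h)).

(* [hom_le u v] holds iff there is a nonzero morphism from M_u to M_v. *)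
Definition hom_le (u v : os n d.+1) : bool :=
  [forall i : 'I_d.+1, ent u i <= ent v i]%N && [forall i : 'I_d, ent v i <= ent u i.+1]%N.

Lemma hom_leP u v :
  reflect ((forall i, (i < d.+1)%N -> (ent u i <= ent v i)%N) /\
           (forall i, (i < d)%N -> (ent v i <= ent u i.+1)%N)) (hom_le u v).
Proof.
apply: (iffP andP) => -[H1 H2]; split.
- by move=> i id; apply: (forallP H1 (Ordinal id)).
- by move=> i id; apply: (forallP H2 (Ordinal id)).
- by apply/forallP => i; apply: H1.
- by apply/forallP => i; apply: H2.
Qed.

End Sequences.

(** * Modules of dimension at most one at each vertex *)

Section ThinModules.
Variables (K : fieldType) (n d : nat).

(** The flag [b] lets a family of interval modules indexed by all of [nat] end in zero modules. *)
Definition supp (b : bool) (x : os n d.+1) (y : os n d) := b && interlaced x y.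

Definition thin_obj b x y : vectType K := 'rV[K]_(supp b x y).

(* M_x if [b], and a zero module otherwise. *)
Program Definition thin b x : module K n d :=
  @Module K n d (thin_obj b x) (fun i y z _ => cmap K (supp b x y) (supp b x z)) _ _.
Next Obligation.
case=> x i j y z z' w yz zw yz' z'w ij; last first.
  by apply/lfunP => v; apply/rowP => -[].
exact: (mod_comm (Mx K x) yz zw yz' z'w ij).
Qed.
Next Obligation.
case=> x i j y z w yz zw ij nz; last first.
  by apply/lfunP => v; apply/rowP => -[].
exact: (mod_zero (Mx K x) yz zw ij nz).
Qed.

Arguments thin : simpl never.

Lemma MxE x : Mx K x = thin true x.
Proof. by rewrite /Mx /thin; f_equal; apply: Prop_irrelevance. Qed.

Definition gen b x y : thin b x y := thin1 K (supp b x y).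
Arguments gen : simpl never.

Lemma genP b x y (v : thin b x y) : exists c, v = c *: gen b x y.
Proof. exact: thin1P. Qed.

Lemma gen_eq0 b x y : (gen b x y == 0) = ~~ supp b x y.
Proof. exact: thin1_eq0. Qed.

Lemma gen0 b x y : ~~ supp b x y -> gen b x y = 0.
Proof. exact: thin1_0. Qed.

Lemma supp_scale b x y : (supp b x y)%:R *: gen b x y = gen b x y.
Proof. by have [_|/gen0 ->] := boolP (supp b x y); rewrite ?scale1r ?scaler0. Qed.

Lemma map_gen b x i y z (yz : step i y z) :
  mod_map (thin b x) yz (gen b x y) = (supp b x y)%:R *: gen b x z.
Proof. exact: cmap1. Qed.

(** Supports are convex: a path with both ends in the support never leaves it, so every path between
    two such vertices acts as the identity. *)
Lemma path_gen b x y z (p : qpath y z) :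
  path_act (thin b x) p (gen b x y) = (supp b x y)%:R *: gen b x z.
Proof.
elim: p => [{}y|i {}y w {}z yw p IH].
  by rewrite path_nilE; apply/esym/supp_scale.
rewrite path_consE map_gen lfunZ IH scalerA -natrM mulnb.
have [/andP[hb xz]|/gen0 ->] := boolP (supp b x z); last by rewrite !scaler0.
rewrite /supp hb /=; case: (boolP (interlaced x y)) => //= xy.
suff -> : interlaced x w by [].
apply: (interlaced_between xy xz) => j; rewrite (path_le p) //=.
by move/stepP: yw => -> //; apply: leq_addr.
Qed.

Section CanonicalMorphism.
Variables (b b' : bool) (u v : os n d.+1) (uv : b -> b' -> hom_le u v).

Definition can_at y : 'Hom(thin b u y, thin b' v y) :=
  cmap K (supp b u y) (supp b' v y).

Lemma can_at_gen y : can_at y (gen b u y) = (supp b u y)%:R *: gen b' v y.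
Proof. exact: cmap1. Qed.

(** For an arrow y -> z with y in the support of M_u and z in that of M_v, chaining the inequalities
    of [hom_le] puts both ends in both supports, so identity maps commute with the arrows. *)
Program Definition can : mor (thin b u) (thin b' v) :=
  @Mor K n d (thin b u) (thin b' v) can_at _.
Next Obligation.
move=> i y z yz; apply/lfunP => a; rewrite !comp_lfunE.
have [c ->] := genP a; rewrite !lfunZ; congr (_ *: _).
rewrite map_gen can_at_gen !lfunZ map_gen can_at_gen.
have [/andP[hb' vz]|/gen0 ->] := boolP (supp b' v z); last by rewrite !scaler0.
have [/andP[hb uy]|_] := boolP (supp b u y); last by rewrite !scale0r.
have /hom_leP [uv1 uv2] := uv hb hb'.
move/interlacedP: vz => vz; move/interlacedP: uy => uy; move/stepP: yz => yz.
rewrite /supp hb hb' /=; congr (_ *: (_%:R *: _)); congr nat_of_bool.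
transitivity true; last symmetry; apply/interlacedP => j jd.
  by have := vz j jd; have := uy j jd; have := uv1 j (ltnW jd); rewrite yz //; lia.
by have := vz j jd; have := uy j jd; have := uv1 j.+1 jd; rewrite yz //; lia.
Qed.

Lemma can_gen y : can y (gen b u y) = (supp b u y)%:R *: gen b' v y.
Proof. exact: cmap1. Qed.

End CanonicalMorphism.

(* The generator of M_u lives at the vertex (u_2, ..., u_(d+1)). *)
Lemma top_exists (u : os n d.+1) :
  exists2 g : os n d, interlaced u g & forall i, (i < d)%N -> ent g i = ent u i.+1.
Proof.
by apply: interlaced_build => i id; rewrite leqnn andbT ent_le.
Qed.

Lemma mor_top u (g : os n d) (V : module K n d) (t : mor (thin true u) V) :
    interlaced u g -> (forall i, (i < d)%N -> ent g i = ent u i.+1) ->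
  forall y, interlaced u y -> exists p : qpath g y,
    t y (gen true u y) = path_act V p (t g (gen true u g)).
Proof.
move=> ug gE y uy; have [i id|p _] := @path_exists _ _ g y.
  by rewrite gE //; have /andP[] := interlacedP _ _ uy i id.
by exists p; rewrite -path_nat path_gen /supp /= ug scale1r.
Qed.

(** The scalar [c] is the image of the generator of M_u at its top vertex [g]. If it is nonzero, [g]
    lies in the support of M_v, which bounds the entries of [v] from above; the lower bounds hold
    because a path out of the support of M_u must also leave that of M_v. *)
Lemma hom_thin (d0 : (0 < d)%N) u b v (t : mor (thin true u) (thin b v)) :
  exists2 c, (c != 0 -> b && hom_le u v)
    & forall y, t y (gen true u y) = (c * (supp true u y)%:R) *: gen b v y.
Proof.
have [g ug gE] := top_exists u; have tt := mor_top t ug gE.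
have [c tg] := genP (t g (gen true u g)).
have [gv|/gen0 gv] := boolP (supp b v g); last first.
  exists 0; rewrite ?eqxx // => y; rewrite mul0r scale0r.
  have [uy|nuy] := boolP (interlaced u y); last by rewrite gen0 ?lfun0.
  by have [p ->] := tt y uy; rewrite tg gv scaler0 lfun0.
exists c => [c0|y]; last first.
  have [uy|nuy] := boolP (interlaced u y).
    have [p ->] := tt y uy; rewrite tg lfunZ path_gen gv scale1r.
    by rewrite /supp /= uy mulr1.
  by rewrite gen0 ?lfun0 // /supp /= (negbTE nuy) mulr0 scale0r.
case/andP: gv => hb /interlacedP gv; rewrite hb /=.
apply/hom_leP; split=> i id; last first.
  by have := gv i id; rewrite gE //; lia.
have [{}id|di] := ltnP i d; last first.
  have := gv d.-1; rewrite gE prednK // => /(_ (leqnn _)).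
  by have -> : i = d by [lia]; lia.
rewrite leqNgt; apply/negP => vu.
(* If [ent v i < ent u i], lowering entry [i] of [g] to [ent u i - 1] gives a vertex in the support
   of M_v but outside that of M_u. *)
have [j jd|z vz zE] := @interlaced_build n d v
  (fun j => if j == i then (ent u i).-1 else ent u j.+1).
  case: eqP => [->|_]; first by have := gv i id; have := ent_le u (leqnSn i) id; rewrite gE //; lia.
  by have := gv j jd; rewrite gE.
have nuz : ~~ interlaced u z.
  apply/negP => /interlacedP/(_ i id); rewrite zE // eqxx; lia.
have [j jd|p _] := @path_exists _ _ g z.
  rewrite gE // zE //; case: eqP => [->|//].
  by have := ent_le u (leqnSn i) id; lia.
have := path_nat t p (gen true u g).
rewrite path_gen (@gen0 true u z) //.
rewrite scaler0 lfun0 tg lfunZ path_gen [supp b v g]/supp hb (introT (interlacedP _ _) gv).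
rewrite scale1r => /esym/eqP; rewrite scaler_eq0 (negbTE c0) gen_eq0.
by rewrite /supp vz.
Qed.

End ThinModules.
Arguments gen {K n d}.

(** * The additive closure of the M_x *)

Section KernelModule.
Variables (K : fieldType) (n d : nat) (V W : module K n d) (f : mor V W).

(** Kernels serve to split off a summand: the complement of M_x is the kernel of a retraction onto
    M_x. *)
Definition ker_obj y : vectType K := subvs_of (lker (f y)).

Definition ker_in y : 'Hom(ker_obj y, V y) := linfun vsval.
Definition ker_out y : 'Hom(V y, ker_obj y) := linfun (vsproj (lker (f y))).

Lemma ker_in_inj y : injective (ker_in y).
Proof. by move=> u v; rewrite !lfunE => /subvs_inj. Qed.

Lemma ker_inK y u : f y (ker_in y u) = 0.
Proof. by rewrite lfunE; have := subvsP u; rewrite memv_ker => /eqP. Qed.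

Lemma ker_outK y v : f y v = 0 -> ker_in y (ker_out y v) = v.
Proof. by move=> fv; rewrite !lfunE /= vsprojK // memv_ker fv. Qed.

Definition ker_map i y z (yz : step i y z) : 'Hom(ker_obj y, ker_obj z) :=
  (ker_out z \o (mod_map V yz \o ker_in y))%VF.

Program Definition ker_mod : module K n d := @Module K n d ker_obj ker_map _ _.
Next Obligation.
move=> i j y z z' w yz zw yz' z'w ij; apply/lfunP => u; apply: ker_in_inj.
rewrite !comp_lfunE !ker_outK ?mor_nat ?ker_inK ?lfun0 // -!comp_lfunE.
by rewrite (mod_comm V yz zw yz' z'w ij).
Qed.
Next Obligation.
move=> i j y z w yz zw ij nz; apply/lfunP => u; apply: ker_in_inj.
rewrite !comp_lfunE !ker_outK ?mor_nat ?ker_inK ?lfun0 //.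
have /lfunP/(_ (ker_in y u)) := mod_zero V yz zw ij nz.
by rewrite comp_lfunE !zero_lfunE lfun0.
Qed.

Program Definition ker_val : mor ker_mod V :=
  @Mor K n d ker_mod V ker_in _.
Next Obligation.
by move=> i y z yz; apply/lfunP => u; rewrite !comp_lfunE ker_outK ?mor_nat ?ker_inK ?lfun0.
Qed.

Lemma ker_val_inj y : injective (ker_val y).
Proof. exact: ker_in_inj. Qed.

Lemma ker_valK y u : f y (ker_val y u) = 0.
Proof. exact: ker_inK. Qed.

Lemma dim_ker_mod y : \dim {: ker_mod y} = \dim (lker (f y)).
Proof. by rewrite dimvf. Qed.

Section Lift.
Variables (T : module K n d) (t : mor T V) (ft : forall y v, f y (t y v) = 0).

Program Definition ker_lift : mor T ker_mod :=
  @Mor K n d T ker_mod (fun y => ker_out y \o t y)%VF _.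
Next Obligation.
move=> i y z yz; apply/lfunP => u; apply: ker_in_inj.
by rewrite !comp_lfunE !ker_outK ?mor_nat ?ft ?lfun0 // -mor_nat ft.
Qed.

Lemma ker_liftK y v : ker_val y (ker_lift y v) = t y v.
Proof. by rewrite comp_lfunE ker_outK. Qed.
End Lift.

End KernelModule.

Section AddClosure.
Variables (K : fieldType) (n d : nat).
Implicit Types V W : module K n d.

(* Sums of morphisms that factor through some M_x with X x. *)
Inductive thru (X : pred (os n d.+1)) V W : mor V W -> Prop :=
| thru_nil (f : mor V W) : (forall y v, f y v = 0) -> thru X f
| thru_cons x (i : mor V (thin K true x)) (p : mor (thin K true x) W)
    (f g : mor V W) : X x -> thru X f -> (forall y v, g y v = p y (i y v) + f y v) -> thru X g.

(** Says that V is a retract of a finite sum of modules M_x with x in X. Closure under summands is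
    then immediate, and vectors of V can be treated by induction on a decomposition of the
    identity. *)
Definition in_add X V := thru X (mor_id V).

Section Closure.
Variable X : pred (os n d.+1).

Lemma thru_add V W (f g h : mor V W) :
  thru X f -> thru X g -> (forall y v, h y v = f y v + g y v) -> thru X h.
Proof.
move=> fX; elim: fX g h => {f}.
  move=> f f0 g h gX hE; case: gX hE => [{}g g0|x i p f' {}g Xx f'X gE] hE.
    by apply: thru_nil => y v; rewrite hE f0 g0 addr0.
  by apply: (thru_cons (f := f') (i := i) (p := p)) => // y v; rewrite hE f0 add0r gE.
move=> x i p f' f Xx _ IH fE g h gX hE.
apply: (thru_cons (f := mor_add f' g) (i := i) (p := p) Xx).
  by apply: IH gX _ => y v; rewrite mor_addE.
by move=> y v; rewrite hE fE mor_addE addrA.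
Qed.

Lemma thru_comp V V' W W' (f : mor V W) (e : mor V' V) (g : mor W W') (h : mor V' W') :
  thru X f -> (forall y v, h y v = g y (f y (e y v))) -> thru X h.
Proof.
move=> fX; elim: fX h => {f}.
  by move=> f f0 h hE; apply: thru_nil => y v; rewrite hE f0 lfun0.
move=> x i p f' f Xx _ IH fE h hE.
apply: (thru_cons (i := mor_comp i e) (p := mor_comp g p)
  (f := mor_comp g (mor_comp f' e)) Xx); first by apply: IH => y v; rewrite !mor_compE.
by move=> y v; rewrite hE fE !mor_compE lfunD.
Qed.

Lemma in_add_retract V W (i : mor V W) (p : mor W V) :
  (forall y v, p y (i y v) = v) -> in_add X W -> in_add X V.
Proof. by move=> pi /(thru_comp (e := i) (g := p)); apply=> y v; rewrite !mor_idE pi. Qed.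

Lemma in_add_iso V W : mod_iso V W -> in_add X W -> in_add X V.
Proof. by case=> f [g [fg _]]; apply: in_add_retract fg. Qed.

Lemma in_add_summand V W : in_add X (mod_sum V W) -> in_add X V.
Proof.
by apply: (@in_add_retract _ _ (mor_inl V W) (mor_fst V W)) => y v; rewrite mor_inlE mor_fstE.
Qed.

Lemma in_add_zero V : mod_is_zero V -> in_add X V.
Proof. by move=> /mod_zeroP V0; apply: thru_nil => y v; apply: V0. Qed.

Lemma in_add_sum V W : in_add X V -> in_add X W -> in_add X (mod_sum V W).
Proof.
move=> VX WX.
apply: (@thru_add _ _ (mor_comp (mor_inl V W) (mor_fst V W))
                      (mor_comp (mor_inr V W) (mor_snd V W))).
- apply: (thru_comp (e := mor_fst V W) (g := mor_inl V W) VX) => y v.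
  by rewrite !mor_compE mor_idE.
- apply: (thru_comp (e := mor_snd V W) (g := mor_inr V W) WX) => y v.
  by rewrite !mor_compE mor_idE.
- move=> y v; rewrite mor_idE !mor_compE mor_inlE mor_inrE mor_fstE mor_sndE.
  by case: v => a b; congr (_, _); rewrite ?addr0 ?add0r.
Qed.

Lemma in_add_thin (b : bool) x : (b -> X x) -> in_add X (thin K b x).
Proof.
case: b => [/(_ isT) Xx|_].
  apply: (thru_cons (i := mor_id _) (p := mor_id _) (f := mor0 _ _) Xx) => [|y v].
    by apply: thru_nil => y v; rewrite mor0E.
  by rewrite !morE addr0.
by apply/in_add_zero/mod_zeroP => y v; apply/rowP => -[].
Qed.

Lemma add_Mx_in V : add_Mx X V -> in_add X V.
Proof.
case=> s sX /in_add_iso; apply; elim: s sX => [_|x s IH /= /andP[Xx /IH]].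
  exact/in_add_zero/mod0_zero.
by apply: in_add_sum; rewrite MxE; apply: in_add_thin.
Qed.

End Closure.

Lemma in_add_sub (X X' : pred (os n d.+1)) V :
  (forall x, X x -> X' x) -> in_add X V -> in_add X' V.
Proof.
rewrite /in_add => XX'; elim=> [f f0|x i p f g Xx _ IH gE]; first exact: thru_nil.
exact: thru_cons (XX' _ Xx) IH gE.
Qed.

(* A nonzero module in add X has a summand M_x: otherwise every composite
   M_x -> V -> M_x vanishes, so that a map M_x -> V, equal to its composite with
   the identity of V, factors through maps M_x' -> V with x' > x. *)
Lemma in_add_split (d0 : (0 < d)%N) (X : pred (os n d.+1)) V :
  in_add X V -> ~ mod_is_zero V ->
  exists x (i : mor V (thin K true x)) (p : mor (thin K true x) V),
    X x /\ forall y v, i y (p y v) = v.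
Proof.
move=> VX; apply: contra_notP => /forallNP nsplit.
have {nsplit} ip0 x (i : mor V (thin K true x)) (p : mor (thin K true x) V) :
    X x -> forall y v, i y (p y v) = 0.
  move=> Xx; have [c cx cE] := hom_thin d0 (mor_comp i p).
  have [c0|c0] := eqVneq c 0.
    move=> y v; have [a ->] := genP v; rewrite !lfunZ -mor_compE cE c0.
    by rewrite mul0r scale0r scaler0.
  have := nsplit x; apply: contra_notP => _.
  exists (mor_scale c^-1 i), p; split=> // y v; have [a ->] := genP v.
  rewrite !lfunZ; congr (_ *: _); rewrite mor_scaleE -mor_compE cE.
  by rewrite scalerA mulrA mulVf // mul1r supp_scale.
have p0 x (p : mor (thin K true x) V) : X x -> forall y v, p y v = 0.
  (* Descending induction on the sum of the entries of [x]: it is at most [n * d.+1] and strictly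
     increases along a nonzero map to a different M_x'. *)
  have [N] := ubnP (n * d.+1 - \sum_(i < d.+1) ent x i)%N.
  elim: N x p => // N IH x p xN Xx y v.
  have -> : p y v = mor_id V y (p y v) by rewrite mor_idE.
  elim: VX => [f ->//|x' i' p' f g Xx' _ IHf gE]; rewrite gE IHf addr0 {f g gE IHf}.
  have [c cx cE] := hom_thin d0 (mor_comp i' p).
  have [xx'|xx'] := eqVneq x x'.
    by subst x'; rewrite ip0 // lfun0.
  have [a ->] := genP v; rewrite !lfunZ -(mor_compE i' p) cE.
  have [->|c0] := eqVneq c 0; first by rewrite mul0r scale0r lfun0 scaler0.
  rewrite !lfunZ IH ?scaler0 //.
  have /hom_leP[le _] := cx c0.
  have lt : (\sum_(i < d.+1) ent x i < \sum_(i < d.+1) ent x' i)%N.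
    rewrite ltnNge; apply: contra_neqN xx' => sle; apply/ent_inj => i.
    apply/eqP; rewrite eqn_leq le //=; move: sle.
    rewrite (bigD1 i) //= [X in (_ <= X)%N](bigD1 i) //=.
    move=> h; rewrite -(leq_add2r (\sum_(j < d.+1 | j != i) ent x' j)%N).
    by apply: leq_trans h _; apply/leq_add/leq_sum => // j _; apply: le.
  have : (\sum_(i < d.+1) ent x' i <= n * d.+1)%N.
    apply: (@leq_trans (\sum_(i < d.+1) n)); last by rewrite sum_nat_const card_ord mulnC.
    by apply: leq_sum => i _; rewrite ltnW // ent_lt.
  by lia.
apply/mod_zeroP => y v; rewrite -[v]mor_idE; elim: VX => [f ->//|x i p f g Xx _ IH ->].
by rewrite IH p0 // addr0.
Qed.

(** Induction on the total dimension: with [i] a retraction of the inclusion [p] of M_x, V is the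
    sum of M_x and the kernel of [i], onto which [id - p i] projects. *)
Lemma in_add_Mx (d0 : (0 < d)%N) (X : pred (os n d.+1)) V : in_add X V -> add_Mx X V.
Proof.
have [N] := ubnP (\sum_y \dim {: V y}); elim: N V => // N IH V VN VX.
have [V0|/(in_add_split d0 VX)] := pselect (mod_is_zero V).
  by exists [::] => //; apply: mod_iso_zero V0 _; apply: mod0_zero.
case=> x [i [p [Xx ip]]].
pose q := mor_add (mor_id V) (mor_scale (-1) (mor_comp p i)).
have qE y v : q y v = v - p y (i y v) by rewrite !morE scaleN1r.
have iq y v : i y (q y v) = 0 by rewrite qE lfunB ip subrr.
pose r := ker_lift iq.
have rK y v : ker_val i y (r y v) = v - p y (i y v) by rewrite ker_liftK qE.
have rker y u : r y (ker_val i y u) = u.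
  by apply: (@ker_val_inj _ _ _ _ _ i); rewrite rK ker_valK lfun0 subr0.
have [||s sX Ws] := IH (ker_mod i).
- rewrite -ltnS; apply: leq_trans VN; rewrite ltnS.
  (* The dimension drops at [g], where [i] is nonzero on the image under [p] of the generator. *)
  have [g xg _] := top_exists x.
  rewrite (bigD1 g) //= [X in (_ < X)%N](bigD1 g) //= -addSn leq_add //; last first.
    by apply: leq_sum => y _; rewrite dim_ker_mod dimvS ?subvf.
  rewrite dim_ker_mod ltn_neqAle dimvS ?subvf // andbT.
  apply/negP => /eqP dimE; have : lker (i g) = fullv.
    by apply/eqP; rewrite -(geq_leqif (dimv_leqif_eq (subvf _))) dimE.
  move=> kf; have : p g (gen true x g) \in lker (i g) by rewrite kf memvf.
  by rewrite memv_ker ip gen_eq0 /supp xg.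
- exact: (in_add_retract (i := ker_val i) rker).
exists (x :: s); first by rewrite /= Xx.
apply: (@mod_iso_trans _ _ _ _ (mod_sum (thin K true x) (ker_mod i))); last first.
  by rewrite /= MxE; apply: mod_iso_sum (mod_iso_refl _) Ws.
exists (mor_pair i r), (mor_copair p (ker_val i)); split=> y.
  by move=> v; rewrite mor_copairE mor_pairE rK addrC subrK.
move=> v; rewrite mor_copairE mor_pairE.
have -> : r y (p y v.1 + ker_val i y v.2) = v.2.
  apply: (@ker_val_inj _ _ _ _ _ i); rewrite rK lfunD ip ker_valK addr0.
  by rewrite addrAC subrr add0r.
by rewrite lfunD ip ker_valK addr0; case: v.
Qed.

Lemma add_MxP (d0 : (0 < d)%N) (X : pred (os n d.+1)) V : add_Mx X V <-> in_add X V.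
Proof. by split; [apply: add_Mx_in|apply: in_add_Mx]. Qed.

Lemma comb_act_nat V W (f : mor V W) y z (c : seq (K * qpath y z)) v :
  f z (comb_act V c v) = comb_act W c (f y v).
Proof.
rewrite /comb_act !sum_lfunE linear_sum; apply: eq_bigr => -[a p] _ /=.
by rewrite !scale_lfunE lfunZ path_nat.
Qed.

(** Combinations of paths act compatibly with morphisms, so one that kills the M_x kills every
    morphism factoring through them, in particular the identity of V. *)
Lemma nakayama_MP (d0 : (0 < d)%N) (l : n.-tuple nat) V :
  nakayama_M l V <-> in_add (os_kupisch l) V.
Proof.
split=> [[_ /add_Mx_in]//|VX]; split; last exact: in_add_Mx.
move=> y z c c0; apply/lfunP => v; rewrite zero_lfunE -[LHS](mor_idE (y := z)).
rewrite comb_act_nat.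
elim: VX => [f f0|x i p f g Xx _ IH gE]; rewrite -comb_act_nat ?f0 ?gE //.
rewrite (comb_act_nat f) IH addr0 (comb_act_nat i).
by have := c0 x Xx; rewrite MxE => ->; rewrite zero_lfunE lfun0.
Qed.

End AddClosure.

(** * Torsion sequences *)

Section TorsionSequences.
Variables (K : fieldType) (n d : nat) (M U : module K n d -> Prop).

Lemma torsion_seq_iso V W : mod_iso V W -> torsion_seq M U V -> torsion_seq M U W.
Proof.
case=> a [b [ab ba]] [UX [Y [f [g [h [H1 [[fm fg gh hh] H3]]]]]]].
exists UX, Y, (mor_comp a f), (mor_comp g b), h; split=> //; split=> //.
move/mor_monoP: fm => fm; move/exact_atP: fg => [fg1 fg2].
move/exact_atP: gh => [gh1 gh2].
split=> //.
- apply/mor_monoP => y v; rewrite mor_compE => /(congr1 (b y)).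
  by rewrite ab lfun0 => /fm.
- apply/exact_atP; split=> y v; rewrite !mor_compE ?ab // => /fg2 [w bv].
  by exists w; rewrite mor_compE -bv ba.
- apply/exact_atP; split=> y v; rewrite ?mor_compE ?gh1 // => /gh2 [w ->].
  by exists (a y w); rewrite mor_compE ab.
Qed.

Lemma torsion_seq_sum V W :
  (forall A B, M A -> M B -> M (mod_sum A B)) ->
  (forall A B, U A -> U B -> U (mod_sum A B)) ->
  torsion_seq M U V -> torsion_seq M U W -> torsion_seq M U (mod_sum V W).
Proof.
move=> Msum Usum.
case=> UV [Y [f [g [h [[MV UUV MY Y0] [[fm fg gh hh] TV]]]]]].
case=> UW [Z [f' [g' [h' [[MW UUW MZ Z0] [[fm' fg' gh' hh'] TW]]]]]].
exists (mod_sum UV UW), (fun k => mod_sum (Y k) (Z k)), (mor_sum f f'),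
  (mor_sum g g'), (fun k => mor_sum (h k) (h' k)).
have exs A A' B B' C C' (p : mor A B) (p' : mor A' B') (q : mor B C) (q' : mor B' C') :
    exact_at p q -> exact_at p' q' -> exact_at (mor_sum p p') (mor_sum q q').
  move=> /exact_atP [e1 e2] /exact_atP [e1' e2']; apply/exact_atP; split=> y [a b].
    by rewrite !mor_sumE /= e1 e1'.
  rewrite mor_sumE => -[/e2 [c ->] /e2' [c' ->]]; exists (c, c').
  by rewrite mor_sumE.
split; [split=> [|||k dk]|split; [split|]].
- exact: Msum.
- exact: Usum.
- by move=> k; apply: Msum.
- by apply/mod_zeroP => y [a b]; congr (_, _); apply: (mod_zeroP _).1; [apply: Y0|apply: Z0].
- move/mor_monoP: fm => fm; move/mor_monoP: fm' => fm'.
  by apply/mor_monoP => y [a b]; rewrite mor_sumE => -[/fm -> /fm' ->].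
- exact: exs.
- exact: exs.
- by move=> k; apply: exs.
move=> T UT; have [TV0 TV1] := TV T UT; have [TW0 TW1] := TW T UT.
have cmp A A' B B' (p : mor A B) (p' : mor A' B') (t : mor T (mod_sum A A')) :
    (forall y, (mor_sum p p' y \o t y)%VF = 0) ->
    (forall y, (p y \o mor_comp (mor_fst A A') t y)%VF = 0) /\
    (forall y, (p' y \o mor_comp (mor_snd A A') t y)%VF = 0).
  move=> t0; split=> y; apply/lfunP => v; have /lfunP/(_ v) := t0 y;
  by rewrite !comp_lfunE ?mor_fstE ?mor_sndE mor_sumE !zero_lfunE => -[].
have ext A A' y (t : mor T (mod_sum A A')) v : t y v =
    (mor_comp (mor_fst A A') t y v, mor_comp (mor_snd A A') t y v).
  by rewrite !mor_compE mor_fstE mor_sndE; case: (t y v).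
split=> [t /cmp[/TV0 t1 /TW0 t2] y|k t /cmp[/TV1[s1 t1] /TW1[s2 t2]]].
  by apply/lfunP => v; rewrite ext t1 t2 !zero_lfunE.
exists (mor_pair s1 s2) => y; apply/lfunP => v.
by rewrite ext t1 t2 !comp_lfunE mor_pairE mor_sumE.
Qed.

Lemma torsion_seq_sub (M' U' : module K n d -> Prop) V :
  (forall W, M W -> M' W) -> (forall W, U W <-> U' W) ->
  torsion_seq M U V -> torsion_seq M' U' V.
Proof.
move=> MM UU [UX [Y [f [g [h [[H1 H2 H3 H4] [H5 H6]]]]]]].
exists UX, Y, f, g, h; split; [split=> //|split=> //].
- exact: MM.
- exact/UU.
- by move=> k; apply: MM.
- by move=> T /UU /H6.
Qed.

Lemma torsion_seq_zero V :
  M (mod0 K n d) -> U (mod0 K n d) -> mod_is_zero V -> torsion_seq M U V.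
Proof.
move=> M0 U0 /mod_zeroP V0.
have Z0 := (mod_zeroP _).1 (@mod0_zero K n d).
exists (mod0 K n d), (fun=> mod0 K n d), (mor0 _ _), (mor0 _ _), (fun=> mor0 _ _).
split; [split=> // k _; exact: mod0_zero|split; [split|]].
- by apply/mor_monoP => y v _; apply: Z0.
- apply/exact_atP; split=> y v; rewrite ?mor0E // => _.
  by exists 0; rewrite lfun0; apply: V0.
- apply/exact_atP; split=> y v; rewrite ?mor0E // => _.
  by exists 0; rewrite lfun0; apply: Z0.
- move=> k; apply/exact_atP; split=> y v; rewrite ?mor0E // => _.
  by exists 0; rewrite lfun0; apply: Z0.
move=> T _; split=> [t _ y|k t _]; first by apply/lfunP => v; rewrite zero_lfunE; apply: Z0.
by exists (mor0 _ _) => y; apply/lfunP => v; rewrite (Z0 _ (t y v)) comp_lfunE (Z0 _ (mor0 _ _ y v)) lfun0.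
Qed.

End TorsionSequences.

(** * Exactness of Hom(T, -) is tested on the summands M_u of T *)

Section TestOnIndecomposables.
Variables (K : fieldType) (n d : nat) (F : pred (os n d.+1)) (T V W : module K n d).
Variable (h : mor V W).
Hypothesis TF : in_add F T.

Lemma test_inj :
  (forall u (t : mor (thin K true u) V), F u -> (forall y v, h y (t y v) = 0) ->
     forall y v, t y v = 0) ->
  forall t : mor T V, (forall y v, h y (t y v) = 0) -> forall y v, t y v = 0.
Proof.
move=> H t ht y v; rewrite -[v]mor_idE; elim: TF => [f ->|u i p f g Fu _ IH ->].
  by rewrite lfun0.
rewrite lfunD IH addr0 -(mor_compE t p); apply: H => // z w.
by rewrite mor_compE ht.
Qed.

Lemma test_lift (V' : module K n d) (h' : mor V' V) :
  (forall u (t : mor (thin K true u) V), F u -> (forall y v, h y (t y v) = 0) ->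
     exists s : mor (thin K true u) V', forall y v, t y v = h' y (s y v)) ->
  forall t : mor T V, (forall y v, h y (t y v) = 0) ->
    exists s : mor T V', forall y v, t y v = h' y (s y v).
Proof.
move=> H t ht.
suff [s sE] : exists s : mor T V', forall y v, t y (mor_id T y v) = h' y (s y v).
  by exists s => y v; rewrite -sE mor_idE.
elim: TF => [f f0|u i p f g Fu _ [s sE] gE].
  by exists (mor0 _ _) => y v; rewrite f0 mor0E !lfun0.
have [|r rE] := H u (mor_comp t p) Fu; first by move=> y v; rewrite mor_compE ht.
exists (mor_add (mor_comp r i) s) => y v.
by rewrite gE mor_addE !lfunD sE mor_compE -rE mor_compE.
Qed.

End TestOnIndecomposables.

(** * Sequences of interval modules and their exactness *)

Section ThinSequence.
Variables (K : fieldType) (n d : nat).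
Hypothesis d0 : (0 < d)%N.

Lemma hom_le_top (u v : os n d.+1) g : hom_le u v -> interlaced u g ->
  (forall i, (i < d)%N -> ent g i = ent u i.+1) -> interlaced v g.
Proof.
move=> /hom_leP [uv1 uv2] _ gE; apply/interlacedP => i id.
by rewrite gE // uv2 // uv1.
Qed.

(** All spaces have dimension at most 1, so exactness says that each vertex in the middle support
    lies in exactly one of the two outer ones, where it must map from the left or to the right. *)
Lemma can_exact (b0 b1 b2 : bool) (v0 v1 v2 : os n d.+1)
    (h0 : b0 -> b1 -> hom_le v0 v1) (h1 : b1 -> b2 -> hom_le v1 v2) :
  (forall y, ~~ [&& supp b0 v0 y, supp b1 v1 y & supp b2 v2 y]) ->
  (forall y, supp b1 v1 y -> supp b0 v0 y || supp b2 v2 y) ->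
  exact_at (can K h0) (can K h1).
Proof.
move=> S3 S1; apply/exact_atP; split=> y v; have [c ->] := genP v.
  rewrite !lfunZ can_gen lfunZ can_gen; have := S3 y.
  have [_|_] := boolP (supp b0 v0 y); last by rewrite scale0r scaler0.
  have [_ /= /gen0 ->|_ _] := boolP (supp b1 v1 y); first by rewrite !scaler0.
  by rewrite scale0r !scaler0.
rewrite lfunZ can_gen => cv.
have [/S1/orP[s0|s2]|/gen0 ->] := boolP (supp b1 v1 y); last first.
- by exists 0; rewrite lfun0 scaler0.
- move/eqP: cv; rewrite scalerA scaler_eq0 gen_eq0 s2 orbF mulf_eq0.
  case/orP => [/eqP ->|]; first by exists 0; rewrite lfun0 scale0r.
  have [_|/gen0 -> _] := boolP (supp b1 v1 y); first by rewrite oner_eq0.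
  by exists 0; rewrite lfun0 scaler0.
- by exists (c *: gen b0 v0 y); rewrite lfunZ can_gen s0 scale1r.
Qed.

(** A map from M_u is a scalar multiple of the canonical one, which is the composite of the
    canonical maps through v0. *)
Lemma hom_thin_lift (b0 b1 : bool) (u v0 v1 : os n d.+1) (h0 : b0 -> b1 -> hom_le v0 v1)
    (t : mor (thin K true u) (thin K b1 v1)) :
  b0 && hom_le u v0 -> exists s : mor (thin K true u) (thin K b0 v0),
    forall y v, t y v = can K h0 y (s y v).
Proof.
move=> /andP[b0T uv0]; have [c cE tE] := hom_thin d0 t.
exists (mor_scale c (@can K _ _ true b0 u v0 (fun _ _ => uv0))) => y v.
have [a ->] := genP v; rewrite !lfunZ tE mor_scaleE can_gen !lfunZ can_gen.
have [c0|c0] := eqVneq c 0; first by rewrite c0 !mul0r !scale0r scaler0.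
rewrite -scalerA; congr (_ *: (_ *: _)).
have [uy|_] := boolP (supp true u y); last by rewrite !scale0r.
rewrite !scale1r; have [v1y|/gen0 ->] := boolP (supp b1 v1 y); last by rewrite scaler0.
suff -> : supp b0 v0 y by rewrite scale1r.
have /andP[b1T /hom_leP[uv1 uv1']] := cE c0.
have /hom_leP [v01 v01'] := h0 b0T b1T; have /hom_leP [u0 u0'] := uv0.
move: uy v1y; rewrite /supp b1T b0T /= => /interlacedP uy /interlacedP vy.
apply/interlacedP => i id.
have := uy i id; have := vy i id; have := v01 i (ltnW id).
by have := u0 i.+1 id; lia.
Qed.

(** If M_u maps nontrivially to both terms, its generator lives at a vertex in both supports, where
    the canonical map is injective. *)
Lemma hom_thin_inj (b1 b2 : bool) (u v1 v2 : os n d.+1) (h1 : b1 -> b2 -> hom_le v1 v2)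
    (t : mor (thin K true u) (thin K b1 v1)) :
  b2 && hom_le u v2 -> (forall y v, can K h1 y (t y v) = 0) ->
  forall y v, t y v = 0.
Proof.
move=> /andP[b2T uv2] ht; have [c cE tE] := hom_thin d0 t.
suff c0 : c = 0.
  move=> y v; have [a ->] := genP v.
  by rewrite !lfunZ tE c0 mul0r scale0r scaler0.
apply/eqP/negPn/negP => c0; have /andP[b1T uv1] := cE c0.
have [g ug gE] := top_exists u.
have := ht g (gen true u g); rewrite tE !lfunZ can_gen /supp /= ug.
rewrite b1T (hom_le_top uv1 ug gE) mulr1 scale1r => /eqP.
by rewrite scaler_eq0 gen_eq0 (negbTE c0) /supp b2T (hom_le_top uv2 ug gE).
Qed.

(** Combinatorial form of a torsion sequence: index 0 is the torsion submodule, index 1 the module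
    itself and index k + 2 the term [V k]. The hypotheses on [S] give exactness of the sequence,
    those on [H] exactness after applying Hom(M_u, -). *)
Lemma thin_torsion_seq (X F : pred (os n d.+1)) (bs : nat -> bool)
    (vs : nat -> os n d.+1) :
  let S k y := supp (bs k) (vs k) y in
  let H u k := bs k && hom_le u (vs k) in
  (forall k, bs k -> bs k.+1 -> hom_le (vs k) (vs k.+1)) ->
  (forall k y, ~~ [&& S k y, S k.+1 y & S k.+2 y]) ->
  (forall k y, S k.+1 y -> S k y || S k.+2 y) ->
  (forall y, S 0%N y -> S 1%N y) ->
  (forall u, F u -> H u 2%N -> H u 3%N) ->
  (forall k u, F u -> H u k.+3 -> H u k.+2 || H u k.+4) ->
  (forall k, bs k -> X (vs k)) ->
  (bs 0%N -> F (vs 0%N)) -> bs 1%N ->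
  (forall k, (d <= k)%N -> ~~ bs k.+2) ->
  torsion_seq (in_add (K := K) X) (in_add F) (thin K true (vs 1%N)).
Proof.
move=> S H hs S3 S1 S0 H2 H3 bX b0F b1 bd; rewrite -[true]b1.
pose m k : mor (thin K (bs k) (vs k)) (thin K (bs k.+1) (vs k.+1)) := can K (@hs k).
have mE k : exact_at (m k) (m k.+1) by apply: can_exact; [apply: S3|apply: S1].
exists (thin K (bs 0%N) (vs 0%N)), (fun k => thin K (bs k.+2) (vs k.+2)),
  (m 0%N), (m 1%N), (fun k => m k.+2).
split; [split=> [|||k dk]|split; [split=> // |]].
- by apply: in_add_thin => /bX.
- by apply: in_add_thin => /b0F.
- by move=> k; apply: in_add_thin => /bX.
- apply/mod_zeroP => y v; have [c ->] := genP v.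
  by rewrite gen0 ?scaler0 // /supp (negbTE (bd _ dk)).
- apply/mor_monoP => y v; have [c ->] := genP v; rewrite lfunZ can_gen.
  have [s0|/gen0 -> //] := boolP (supp (bs 0%N) (vs 0%N) y); last by rewrite !scaler0.
  rewrite scale1r => /eqP; rewrite scaler_eq0 gen_eq0.
  by have := S0 _ s0; rewrite /S => ->; rewrite orbF => /eqP ->; rewrite scale0r.
have homH k u (t : mor (thin K true u) (thin K (bs k) (vs k))) :
    ~~ H u k -> forall y v, t y v = 0.
  move=> nH; have [c cE tE] := hom_thin d0 t.
  have [c0|c0] := eqVneq c 0; last by rewrite /H cE in nH.
  move=> y v; have [a ->] := genP v.
  by rewrite !lfunZ tE c0 mul0r scale0r scaler0.
move=> T TF; split=> [t ht y|k t ht].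
  apply/lfunP => v; rewrite zero_lfunE; apply: (test_inj (h := m 2%N) TF _ _ (t := t)).
    move=> u s Fu hs0; have [h2|nh] := boolP (H u 2%N); last exact: homH nh.
    exact: hom_thin_inj (H2 u Fu h2) hs0.
  by move=> z w; have /lfunP/(_ w) := ht z; rewrite comp_lfunE zero_lfunE.
have [|z w|s sE] := test_lift (h := m k.+3) (h' := m k.+2) TF _ (t := t); last first.
- by exists s => y; apply/lfunP => v; rewrite comp_lfunE sE.
- by have /lfunP/(_ w) := ht z; rewrite comp_lfunE zero_lfunE.
move=> u s Fu hs0.
have [|nh] := boolP (H u k.+2); first exact: hom_thin_lift.
exists (mor0 _ _) => y v; rewrite mor0E lfun0.
have [h3|nh3] := boolP (H u k.+3); last exact: homH nh3 _ _.
have := H3 k u Fu h3; rewrite (negbTE nh) /= => h4.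
exact: hom_thin_inj h4 hs0 _ _.
Qed.

End ThinSequence.

(** * Closed sets of sequences *)

Section ClosedSets.
Variables n d : nat.
Implicit Types (X F : pred (os n d.+1)) (x v : os n d.+1).

(** Membership depends only on the interval from the first to the last entry and passes to
    subintervals. This is all that is used of a Kupisch series. *)
Definition admissible X := forall x v,
  X x -> (ent x 0 <= ent v 0)%N -> (ent v d <= ent x d)%N -> X v.

(* The subsets of X corresponding to the d-torsion classes of add X. *)
Definition tors_closed X F :=
  [/\ forall x, F x -> X x,
      forall x v, F x -> ent v d = ent x d ->
        (forall i, (i < d)%N -> (ent x i <= ent v i)%N) -> F v
    & forall x w v, F x -> F w -> (ent x d < ent w d)%N ->
        (forall i, (i < d)%N -> ent w i = (ent x d).+1) ->
        (forall i, (i < d)%N -> ent v i = ent x i) -> ent v d = ent w d ->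
        X v -> F v].

Lemma os_fun (f : nat -> nat) :
  (forall i, (i < d)%N -> (f i < n)%N) ->
  (forall i, (i.+1 < d)%N -> (f i <= f i.+1)%N) ->
  exists y : os n d, forall i, (i < d)%N -> ent y i = f i.
Proof.
move=> f1 f2; have [y yE] := os_build f1 f2.
by exists y => i id; apply: (yE (Ordinal id)).
Qed.

End ClosedSets.

Lemma os_with_last n d (x : os n d.+1) k : (0 < d)%N -> (ent x d.-1 <= k < n)%N ->
  exists v : os n d.+1, (forall i, (i < d)%N -> ent v i = ent x i) /\ ent v d = k.
Proof.
move=> d0 xk; have [i id|i id|v vE] := @os_fun n d.+1 (fun i => if (i < d)%N then ent x i else k).
- by have := ent_lt x id; case: (ltnP i d) => //; lia.
- case: (ltnP i.+1 d) => di'; first by rewrite (ltnW di') ent_le // ltnW.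
  case: ltnP => di; last by lia.
  by have -> : i = d.-1 by [lia]; lia.
exists v; split=> [i id|]; first by rewrite vE ?id // ltnW ?id.
by rewrite vE // ltnn.
Qed.

(* For a_0 <= ... <= a_(d+1), put V_t := (a_0, ..., a_(t-1), a_(t+1) + 1, ..., a_(d+1) + 1).
   Then 0 -> M_(V_(d+1)) -> M_(V_d) -> ... -> M_(V_0) -> 0 is exact; with a_(d+1) + 1 = j and
   a_d = k its first map is the inclusion of M_(a_0,...,a_(d-1),k) in M_(a_0,...,a_(d-1),j). *)
Section Resolution.
Variables (n d : nat) (a : nat -> nat) (V : nat -> os n d.+1).
Hypothesis amono : forall i, (i <= d)%N -> (a i <= a i.+1)%N.
Hypothesis VE : forall t i, (t <= d.+1)%N -> (i <= d)%N ->
  ent (V t) i = if (i < t)%N then a i else (a i.+1).+1.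

(* Common form of [hom_le u v] and, by adding a first entry 0, of [interlaced v y]. *)
Definition below (u : nat -> nat) (v : os n d.+1) :=
  (forall i, (i <= d)%N -> (u i <= ent v i)%N) /\
  (forall i, (i < d)%N -> (ent v i <= u i.+1)%N).

Lemma hom_le_below u v : hom_le u v <-> below (ent u) v.
Proof. by split=> [/hom_leP|H]; last exact/hom_leP. Qed.

(** The sequence (0, y_1, ..., y_d) belongs to the indecomposable projective at y, and a map from it
    to M_v is a vector of M_v at y. One set of inequalities thus handles exactness at vertices and
    exactness of Hom. *)
Definition cons0 (y : os n d) (i : nat) : nat := if i is j.+1 then ent y j else 0.

Lemma interlaced_below v y : interlaced v y <-> below (cons0 y) v.
Proof.
split=> [/interlacedP vy|[H1 H2]].
  by split=> -[|i] id //=; have := vy _ id; lia.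
by apply/interlacedP => i id; have := H2 i id; have := H1 i.+1 id => /= -> ->.
Qed.

Lemma resolution_hom t : (t <= d)%N -> hom_le (V t.+1) (V t).
Proof.
move=> td; apply/hom_leP; split=> i id; rewrite !VE //; try lia.
  have := amono (i := i); have := amono (i := i.+1).
  by case: (ltnP i t.+1) => it; case: (ltnP i t) => it'; lia.
have := amono (i := i); have := amono (i := i.+1).
by case: (ltnP i.+1 t.+1) => it; case: (ltnP i t) => it'; lia.
Qed.

(** The two hypotheses bound [u t.+1] by [a t.+1] from above and by [(a t.+1).+1] from below. *)
Lemma resolution_complex t u : (t.+2 <= d.+1)%N ->
  below u (V t.+2) -> below u (V t) -> False.
Proof.
move=> td [H1 _] [_ H2]; have := H1 t.+1 td; have := H2 t td.
by rewrite !VE // ?ltnn ?leqnn //; lia.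
Qed.

(** [V t] and [V t.+1] differ in entry [t] alone, which is [(a t.+1).+1] in the first and [a t] in
    the second. Comparing [u t] with [a t] therefore decides whether a sequence below [V t] passes
    to [V t.+1] or, if [t > 0], to [V t.-1]. *)
Lemma resolution_up t u : (t <= d)%N -> (u t <= a t)%N -> below u (V t) -> below u (V t.+1).
Proof.
move=> td ut [H1 H2]; split=> i id; rewrite VE //; try lia.
  have := H1 i id; rewrite VE //; try lia.
  case: (ltnP i t) => ti; case: (ltnP i t.+1) => it //; try lia.
  by have -> : i = t by lia.
have := H2 i id; rewrite VE //; try lia; have := amono (i := i).
by case: (ltnP i t) => it; case: (ltnP i t.+1) => it'; lia.
Qed.

Lemma resolution_down t u : (t <= d)%N -> ((t < d)%N -> (a t.+1 < u t.+1)%N) ->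
  below u (V t.+1) -> below u (V t).
Proof.
move=> td ut [H1 H2]; split=> i id; rewrite VE //; try lia.
  have := H1 i id; rewrite VE //; try lia; have := amono (i := i).
  by case: (ltnP i t.+1) => it; case: (ltnP i t) => it'; lia.
have := H2 i id; rewrite VE //; try lia.
case: (ltnP i t.+1) => it; case: (ltnP i t) => it'; try lia.
by have ei : i = t by [lia]; subst i => _; apply: ut.
Qed.

End Resolution.

Lemma resolution_exists n d (a : nat -> nat) :
  (forall i, (i <= d)%N -> (a i <= a i.+1)%N) -> ((a d.+1).+1 < n)%N ->
  exists V : nat -> os n d.+1, forall t i, (t <= d.+1)%N -> (i <= d)%N ->
    ent (V t) i = if (i < t)%N then a i else (a i.+1).+1.
Proof.
move=> amono an.
have ale i j : (i <= j)%N -> (j <= d.+1)%N -> (a i <= a j)%N.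
  elim: j => [|j IH]; first by case: i.
  by rewrite leq_eqVlt => /orP[/eqP -> //|ij jd]; apply: leq_trans (IH ij (ltnW jd)) (amono _ jd).
suff /choice [V VE] : forall t, exists v : os n d.+1, forall i, (i <= d)%N ->
    ent v i = if (i < t)%N then a i else (a i.+1).+1.
  by exists V => t i _; apply: VE.
move=> t; have [i id|i id|v vE] := @os_fun n d.+1 (fun i => if (i < t)%N then a i else (a i.+1).+1).
- have := ale i d.+1; have := ale i.+1 d.+1; case: (ltnP i t) => _; lia.
- have := amono i; have := amono i.+1.
  by case: (ltnP i t) => it; case: (ltnP i.+1 t) => it'; lia.
- by exists v => i id; apply: vE.
Qed.

(** * Closed sets give torsion classes *)

Section Sufficiency.
Variables (K : fieldType) (n d : nat).
Hypothesis d0 : (0 < d)%N.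
Variables X F : pred (os n d.+1).
Hypothesis admX : admissible X.
Hypothesis closedF : tors_closed X F.

Let FX x : F x -> X x. Proof. by case: closedF => H _ _; apply: H. Qed.
Let Fup x v : F x -> ent v d = ent x d ->
  (forall i, (i < d)%N -> (ent x i <= ent v i)%N) -> F v.
Proof. by case: closedF => _ H _; apply: H. Qed.
Let Fext x w v : F x -> F w -> (ent x d < ent w d)%N ->
  (forall i, (i < d)%N -> ent w i = (ent x d).+1) ->
  (forall i, (i < d)%N -> ent v i = ent x i) -> ent v d = ent w d -> X v -> F v.
Proof. by case: closedF => _ _ H; apply: H. Qed.

(** The candidates for the torsion submodule of M_x are the M_(x_1, ..., x_d, k) with k at most the
    last entry of x. *)
Let with_last (x : os n d.+1) (k : nat) : bool :=
  [exists v : os n d.+1, [&& F v, [forall i : 'I_d, ent v i == ent x i] & ent v d == k]].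

Let with_lastP x k : reflect (exists v, [/\ F v,
  forall i, (i < d)%N -> ent v i = ent x i & ent v d = k]) (with_last x k).
Proof.
apply: (iffP existsP) => [[v /and3P[Fv /forallP vE /eqP vk]]|[v [Fv vE vk]]]; exists v.
  by split=> // i id; apply/eqP: (vE (Ordinal id)).
by rewrite Fv vk eqxx andbT /=; apply/forallP => i; rewrite vE.
Qed.

(** The new sequence arises from [u] by raising entries other than the last. *)
Let hom_with_last x u : F u -> hom_le u x -> with_last x (ent u d).
Proof.
move=> Fu /hom_leP[ux xu]; have [|v [vE vd]] := @os_with_last n d x (ent u d) d0.
  by rewrite ent_lt // andbT; have := xu d.-1; rewrite prednK // => ->.
apply/with_lastP; exists v; split=> //; apply: Fup Fu _ _ => // i id.
by rewrite vE // ux // ltnW.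
Qed.

(** Three cases: M_x is torsion; no candidate is torsion and M_x is torsion-free; or the largest
    torsion candidate has last entry k < [ent x d], and the sequence of the V_t with a = (x_1, ...,
    x_d, k, [ent x d] - 1) is a torsion sequence. *)
Lemma torsion_seq_Mx x : X x ->
  torsion_seq (in_add (K := K) X) (in_add F) (thin K true x).
Proof.
move=> Xx.
have refl : hom_le x x by apply/hom_leP; split=> i id //; apply: ent_le.
have [Fx|Fx] := boolP (with_last x (ent x d)).
  have {}Fx : F x.
    case/with_lastP: Fx => v [Fv vE vd]; suff -> : x = v by [].
    apply: entP => i; rewrite ltnS leq_eqVlt => /orP[/eqP -> //|id].
    by rewrite vE.
  apply: (@thin_torsion_seq _ _ _ d0 _ _ (fun k => (k <= 1)%N) (fun=> x)) => //=.
  - by move=> [|[|k]] y; rewrite /supp /= ?andbF.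
  - by move=> [|k] y; rewrite /supp /= ?orbF.
have [/existsP [k1 Fk1]|none] := boolP [exists k : 'I_(ent x d), with_last x k]; last first.
  apply: (@thin_torsion_seq _ _ _ d0 _ _ (fun k => (0 < k <= 2)%N) (fun=> x)) => //=.
  - by move=> [|[|k]] y; rewrite /supp /= ?andbF.
  - by move=> [|[|k]] y; rewrite /supp /= ?orbF.
  - move=> u Fu ux; have ul := hom_with_last Fu ux; have /hom_leP[/(_ d (leqnn _))] := ux.
    rewrite leq_eqVlt => /orP[/eqP ud|ud _]; first by rewrite -ud ul in Fx.
    by case/negP: none; apply/existsP; exists (Ordinal ud).
  - by case: d d0 => // ? _ [].
pose P (k : nat) := with_last x k && (k < ent x d)%N.
have exP : exists k, P k by exists (k1 : nat); rewrite /P Fk1 ltn_ord.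
have ubP k : P k -> (k <= ent x d)%N by case/andP => _ /ltnW.
case: (ex_maxnP exP ubP) => k /andP[/with_lastP [v [Fv vE vk]] kx] kmax.
have {}kmax k' : with_last x k' -> (k' <= ent x d)%N -> (k' <= k)%N.
  move=> Fk'; rewrite leq_eqVlt => /orP[/eqP xk|k'x]; last by apply: kmax; rewrite /P Fk'.
  by rewrite -xk Fk' in Fx.
pose a i := if (i < d)%N then ent x i else if i == d then k else (ent x d).-1.
have aE i : (i < d)%N -> a i = ent x i by rewrite /a => ->.
have ad : a d = k by rewrite /a ltnn eqxx.
have ad1 : a d.+1 = (ent x d).-1 by rewrite /a ltnNge leqnSn /= gtn_eqF.
have amono i : (i <= d)%N -> (a i <= a i.+1)%N.
  rewrite leq_eqVlt => /orP[/eqP ->|id]; first by rewrite ad ad1; lia.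
  rewrite aE //; have [id'|di] := ltnP i.+1 d; first by rewrite aE // ent_le // ltnW.
  by have -> : i.+1 = d by [lia]; rewrite ad -vE // -vk ent_le // ltnW.
have [|V VE] := resolution_exists (n := n) amono.
  by rewrite ad1 prednK; [apply: ent_lt|lia].
have Vd : V d = x.
  apply: entP => i; rewrite ltnS => id; rewrite VE //.
  case: ltnP => di; first exact: aE.
  by have -> : i = d by [lia]; rewrite ad1 prednK //; lia.
have Vd1 : V d.+1 = v.
  apply: entP => i; rewrite ltnS => id; rewrite VE // ltnS id.
  move: id; rewrite leq_eqVlt => /orP[/eqP ->|id]; first by rewrite ad.
  by rewrite aE // vE.
have V0 t : (t <= d)%N -> X (V t).
  move=> td; apply: (admX Xx); rewrite VE ?(leqW td) //.
    case: ltnP => _; first by rewrite aE.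
    by have := amono 0%N; rewrite aE //; lia.
  by rewrite ltnNge td /= ad1; lia.
have ale i : (i <= d)%N -> (a i <= k)%N.
  rewrite leq_eqVlt => /orP[/eqP -> |id]; first by rewrite ad.
  by rewrite aE // -vE // -vk ent_le // ltnW.
have top_gt (u : os n d.+1) t : (t < d)%N -> below (ent u) (V t) -> (k < ent u d)%N.
  move=> td [_ /(_ d.-1)]; rewrite prednK // VE; try lia.
  by rewrite prednK // ad (leqNgt d t) td; apply.
(* A map to M_x would make (x_1, ..., x_d, [ent u d]) torsion with [k < ent u d <= ent x d], against
   the choice of [k]. *)
have nup (u : os n d.+1) t : F u -> (t < d)%N -> below (ent u) (V t) -> ~ hom_le u x.
  move=> Fu td ut ux; have ul := hom_with_last Fu ux.
  have /hom_leP[/(_ d (leqnn _)) /(kmax _ ul)] := ux.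
  by have := top_gt u t td ut; lia.
(* By contradiction with the maximality of [k]: raising [u] gives w = (k+1, ..., k+1, [ent u d]) in
   F, and the extension condition for [v] and [w] puts (x_1, ..., x_d, [ent u d]) in F. *)
have ext0 (u : os n d.+1) : F u -> below (ent u) (V 0%N) -> (ent u 0 <= a 0)%N.
  move=> Fu u0; have kud := top_gt u 0%N d0 u0; case: u0 => [u0 u0'].
  have udx : (ent u d <= ent x d)%N.
    by have := u0 d (leqnn _); rewrite VE //= ad1 prednK //; lia.
  have [||w wE] := @os_fun n d.+1 (fun i => if (i < d)%N then k.+1 else ent u d).
  - move=> i _; have := ent_lt u (leqnn d.+1); case: (ltnP i d) => _; lia.
  - by move=> i _; case: (ltnP i d) => ?; case: (ltnP i.+1 d) => ?; lia.
  have Fw : F w.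
    apply: (Fup Fu) => [|i id]; first by rewrite wE // ltnn.
    rewrite wE ?(leqW id) ?id //; have := u0 i (ltnW id); rewrite VE ?(ltnW id) //= => h.
    by apply: leq_trans h _; apply: ale.
  have [|v' [v'E v'd]] := @os_with_last n d x (ent u d) d0.
    rewrite ent_lt // andbT; have := ent_le v (leq_pred d) (leqnn d.+1).
    by rewrite vE ?prednK // vk; lia.
  have Fv' : F v'.
    apply: (Fext Fv Fw) => [|i id|i id||].
    - by rewrite wE // ltnn vk.
    - by rewrite wE ?(leqW id) ?id ?vk.
    - by rewrite v'E // vE.
    - by rewrite v'd wE // ltnn.
    - by apply: (admX Xx); rewrite ?v'd // v'E.
  have : with_last x (ent u d) by apply/with_lastP; exists v'.
  by move/kmax => /(_ udx); lia.
have step_up t u : (t <= d)%N -> (u t <= a t)%N -> below u (V t) -> below u (V t.+1).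
  exact: resolution_up.
have step_down t u : (t <= d)%N -> ((t < d)%N -> (a t.+1 < u t.+1)%N) ->
  below u (V t.+1) -> below u (V t) by exact: resolution_down.
(* The V_t are read backwards: [V d.+1 = v] is the torsion submodule, [V d = x], and [V 0] is the
   last term. *)
have -> : x = V (d.+1 - 1)%N by rewrite subn1.
apply: (@thin_torsion_seq _ _ _ d0 _ _ (fun k => k <= d.+1)%N (fun k => V (d.+1 - k)%N)) => //=.
- move=> k' _ kd; rewrite subSS subSn //.
  exact: (resolution_hom amono VE (leq_subr k' d)).
- move=> k' y; apply/negP => /and3P[/andP[_ /interlaced_below s0] _].
  move=> /andP[kd /interlaced_below s2].
  apply: (resolution_complex VE _ _ s2 (t := d.+1 - k'.+2)%N); first by lia.
  by have -> : ((d.+1 - k'.+2).+2 = (d.+1 - k'))%N by lia.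
- move=> k' y /andP[kd /interlaced_below s1]; rewrite subSS in s1.
  have td : (d - k' <= d)%N by apply: leq_subr.
  have [ut|ut] := leqP (cons0 y (d - k')%N) (a (d - k')%N).
    apply/orP; left; rewrite /supp ltnW //; apply/interlaced_below.
    by rewrite subSn //; apply: step_up.
  apply/orP; right; have [t0|t0] := posnP (d - k')%N; first by rewrite t0 in ut.
  rewrite /supp; have -> /= : (k'.+2 <= d.+1)%N by lia.
  apply/interlaced_below; apply: step_down; try lia.
    by have -> : ((d.+1 - k'.+2).+1 = (d - k'))%N by lia.
  by have -> : ((d.+1 - k'.+2).+1 = (d - k'))%N by lia.
- move=> y s0; have {s0} : interlaced (V (d.+1 - 0)%N) y by [].
  rewrite subn0 subn1 => /interlaced_below s0;
  suff : interlaced (V d) y by []; apply/interlaced_below; apply: step_down s0 => //.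
  by rewrite ltnn.
(* A map to [V d.-1] either lifts to [V d = x], which [nup] excludes, or stays nonzero in the
   following term. For [d = 1] there is no following term, and [ext0] excludes the map. *)
- move=> u Fu /andP[kd /hom_le_below s2].
  have td : (d.-1 < d)%N by lia.
  have E : (d.+1 - 2)%N = d.-1 by lia.
  rewrite E in s2; have [ut|ut] := leqP (ent u d.-1) (a d.-1).
    have := step_up _ _ (ltnW td) ut s2; rewrite prednK // Vd => /hom_le_below.
    by move/(nup _ _ Fu td s2).
  have [t0|t0] := posnP d.-1; first by rewrite t0 in ut s2; have := ext0 u Fu s2; lia.
  have -> /= : (3 <= d.+1)%N by lia.
  have E' : ((d.+1 - 3).+1 = d.-1)%N by lia.
  apply/hom_le_below; apply: step_down; rewrite ?E' //; lia.
- move=> k' u Fu /andP[kd /hom_le_below s2].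
  have [ut|ut] := leqP (ent u (d.+1 - k'.+3)%N) (a (d.+1 - k'.+3)%N).
    apply/orP; left; rewrite ltnW //; apply/hom_le_below.
    have -> : ((d.+1 - k'.+2) = (d.+1 - k'.+3).+1)%N by lia.
    by apply: step_up => //; lia.
  apply/orP; right; have [t0|t0] := posnP (d.+1 - k'.+3)%N.
    by rewrite t0 in ut s2; have := ext0 u Fu s2; lia.
  have -> /= : (k'.+4 <= d.+1)%N by lia.
  have E' : ((d.+1 - k'.+4).+1 = (d.+1 - k'.+3))%N by lia.
  apply/hom_le_below; apply: step_down; rewrite ?E' //; lia.
- move=> [|k'] kd; first by rewrite subn0 Vd1 FX.
  by apply: V0; rewrite subSS leq_subr.
- by move=> _; rewrite subn0 Vd1.
- by move=> k'; lia.
Qed.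

Lemma torsion_seq_in_add V : in_add X V -> torsion_seq (in_add (K := K) X) (in_add F) V.
Proof.
move=> /(in_add_Mx d0) [s sX /mod_iso_sym Vs]; apply: torsion_seq_iso Vs _.
elim: s sX => [_|x s IH /= /andP[Xx /IH sX]].
  apply: torsion_seq_zero; try exact: mod0_zero.
    by apply: in_add_zero; apply: mod0_zero.
  by apply: in_add_zero; apply: mod0_zero.
apply: torsion_seq_sum => //; try exact: in_add_sum.
by rewrite MxE; apply: torsion_seq_Mx.
Qed.

End Sufficiency.

(** * From torsion classes to closed sets *)

(* The vertices y_m := (a_1, ..., a_m, a_(m+2) + 1, ..., a_(d+1) + 1): the modules
   generated at y_0, ..., y_d form a projective resolution of M_u, where
   u := (a_1 + 1, ..., a_(d+1) + 1); hence evaluating a module at y_0 -> ... -> y_d computes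
   its extensions by M_u, and these vanish in the middle for modules in add X. *)
Section ProjectiveResolution.
Variables (K : fieldType) (n d : nat) (X : pred (os n d.+1)).
Hypothesis d0 : (0 < d)%N.
Variables (a : nat -> nat) (u : os n d.+1) (y : nat -> os n d).
Hypothesis amono : forall i, (i <= d)%N -> (a i <= a i.+1)%N.
Hypothesis uE : forall i, (i <= d)%N -> ent u i = (a i.+1).+1.
Hypothesis yE : forall m i, (m <= d)%N -> (i < d)%N ->
  ent (y m) i = if (i < m)%N then a i.+1 else (a i.+2).+1.
Variable p : forall m, (m < d)%N -> qpath (y m) (y m.+1).

Lemma top_y0 : interlaced u (y 0%N).
Proof.
apply/interlacedP => i id; rewrite !uE ?yE //=; last exact: ltnW.
by have := amono (i := i.+1) id; lia.
Qed.

Lemma y0E i : (i < d)%N -> ent (y 0%N) i = ent u i.+1.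
Proof. by move=> id; rewrite uE // yE. Qed.

Lemma y1_notin : ~~ interlaced u (y 1%N).
Proof.
by apply/negP => /interlacedP/(_ 0%N d0); rewrite uE // yE //= ltnn.
Qed.

Lemma y_complex v m : (m.+2 <= d)%N -> interlaced v (y m) -> ~~ interlaced v (y m.+2).
Proof.
move=> md /interlacedP vm; apply/negP => /interlacedP vm2.
have := vm m (ltnW md); have := vm2 m.+1 md; rewrite !yE ?ltnn ?leqnn //; lia.
Qed.

(** [y m.+1] and [y m.+2] differ in entry [m.+1] alone, so leaving the support forces
    [a m.+2 < ent v m.+1]; this is the bound needed for the larger entry [m] of [y m]. *)
Lemma y_exact v m : (m.+2 <= d)%N -> interlaced v (y m.+1) ->
  ~~ interlaced v (y m.+2) -> interlaced v (y m).
Proof.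
move=> md /interlacedP vm nv.
have lt : (a m.+2 < ent v m.+1)%N.
  rewrite ltnNge; apply: contra nv => le; apply/interlacedP => i id.
  have := vm i id; rewrite !yE //; try lia.
  case: (ltnP i m.+1) => im; case: (ltnP i m.+2) => im'; try lia.
  have ei : i = m.+1 by lia.
  by subst i => H; have := amono (i := m.+2) id; lia.
apply/interlacedP => i id; have := vm i id; rewrite !yE //; try lia.
case: (ltnP i m.+1) => im; case: (ltnP i m) => im'; try lia.
have ei : i = m by lia.
by subst i => H; have := amono (i := m.+1); lia.
Qed.

(** The case of M_v in the identification of Hom(M_u, N) with the kernel of N(y_0) -> N(y_1). *)
Lemma y_hom v : interlaced v (y 0%N) -> ~~ interlaced v (y 1%N) -> hom_le u v.
Proof.
move=> /interlacedP v0 nv.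
have lt : (a 1%N < ent v 0)%N.
  rewrite ltnNge; apply: contra nv => le; apply/interlacedP => -[|i] id.
    by have := v0 0%N id; have := amono (i := 1%N) id; rewrite !yE //= le => + /andP[_]; lia.
  by have := v0 i.+1 id; rewrite !yE.
apply/hom_leP; split=> [[|i]|i] id; first by rewrite uE.
  by have := v0 i id; rewrite yE //= uE // => /andP[].
by have := v0 i id; rewrite yE //= uE // => /andP[].
Qed.

Variable N : module K n d.
Hypothesis NX : in_add X N.

Lemma path_complex m (m1 : (m.+1 < d)%N) (m0 : (m < d)%N) b :
  path_act N (p m1) (path_act N (p m0) b) = 0.
Proof.
rewrite -[b]mor_idE; elim: NX b => [f f0 b|v i q f g _ _ IH gE b].
  by rewrite f0 !lfun0.
rewrite gE !lfunD IH addr0 -!(path_nat q).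
have [c ->] := genP (i (y m) b); rewrite !lfunZ path_gen lfunZ path_gen.
have [vm|_] := boolP (supp true v (y m)); last by rewrite scale0r lfun0 scaler0.
by rewrite (@gen0 _ _ _ true v (y m.+2)) ?(y_complex m1 vm) // !scaler0 lfun0 scaler0.
Qed.

Lemma path_exact m (m1 : (m.+1 < d)%N) (m0 : (m < d)%N) b :
  path_act N (p m1) b = 0 -> exists b', b = path_act N (p m0) b'.
Proof.
move=> pb; rewrite -[b]mor_idE; elim: NX => [f f0|v i q f g _ _ [b' IH] gE].
  by exists 0; rewrite f0 lfun0.
suff [b1 b1E] : exists b1, i (y m.+1) b = path_act (thin K true v) (p m0) b1.
  by exists (q (y m) b1 + b'); rewrite gE IH b1E lfunD path_nat.
have := path_nat i (p m1) b; rewrite pb lfun0.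
have [c ->] := genP (i (y m.+1) b); rewrite lfunZ path_gen.
have [v1|nv1 _] := boolP (supp true v (y m.+1)); last first.
  by exists 0; rewrite lfun0 gen0 // scaler0.
rewrite scale1r => /esym/eqP; rewrite scaler_eq0 gen_eq0 => /orP[/eqP ->|v2].
  by exists 0; rewrite lfun0 scale0r.
exists (c *: gen true v (y m)); rewrite lfunZ path_gen.
by rewrite /supp /= (y_exact m1 v1 v2) scale1r.
Qed.

Lemma path_hom b : path_act N (p d0) b = 0 ->
  exists t : mor (thin K true u) N, t (y 0%N) (gen true u (y 0%N)) = b.
Proof.
move=> pb; rewrite -[b]mor_idE; elim: NX => [f f0|v i q f g _ _ [t tE] gE].
  by exists (mor0 _ _); rewrite mor0E f0.
suff [s sE] : exists s : mor (thin K true u) (thin K true v),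
    s (y 0%N) (gen true u (y 0%N)) = i (y 0%N) b.
  by exists (mor_add (mor_comp q s) t); rewrite mor_addE mor_compE sE tE gE.
have := path_nat i (p d0) b; rewrite pb lfun0.
have [c ->] := genP (i (y 0%N) b); rewrite lfunZ path_gen.
have [v1|nv1 _] := boolP (supp true v (y 0%N)); last first.
  by exists (mor0 _ _); rewrite mor0E gen0 // scaler0.
rewrite scale1r => /esym/eqP; rewrite scaler_eq0 gen_eq0 => /orP[/eqP ->|v2].
  by exists (mor0 _ _); rewrite mor0E scale0r.
exists (mor_scale c (@can K _ _ true true u v (fun _ _ => y_hom v1 v2))).
by rewrite mor_scaleE can_gen /supp /= top_y0 scale1r.
Qed.

End ProjectiveResolution.

Lemma hom_le_anti n d (x y : os n d.+1) : hom_le x y -> hom_le y x -> x = y.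
Proof.
move=> /hom_leP[xy _] /hom_leP[yx _]; apply: entP => i id.
by apply/eqP; rewrite eqn_leq xy ?yx.
Qed.

(** X is recovered from add X: a summand M_x' of M_x has nonzero maps to and from M_x, and [hom_le]
    is antisymmetric. *)
Lemma in_add_thinP (K : fieldType) n d (d0 : (0 < d)%N) (X : pred (os n d.+1)) x :
  in_add X (thin K true x) <-> X x.
Proof.
split=> [xX|Xx]; last exact: in_add_thin.
have [g xg _] := top_exists x.
have nz : ~ mod_is_zero (thin K true x).
  move/mod_zeroP/(_ g (gen true x g))/eqP; rewrite gen_eq0.
  by rewrite /supp xg.
have [x' [i [p [Xx' ip]]]] := in_add_split d0 xX nz.
have [g' xg' _] := top_exists x'.
have [c cE pE] := hom_thin d0 p; have [c' cE' iE] := hom_thin d0 i.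
have : gen true x' g' != 0 :> thin K true x' g' by rewrite gen_eq0 /supp xg'.
rewrite -(ip g' (gen true x' g')) pE lfunZ iE.
have [->|c0] := eqVneq c 0; first by rewrite mul0r scale0r eqxx.
have [->|c0'] := eqVneq c' 0; first by rewrite mul0r scale0r scaler0 eqxx.
by rewrite (hom_le_anti (cE' c0') (cE c0)).
Qed.

(** * The set of indecomposables of a torsion class is closed *)

Section Necessity.
Variables (K : fieldType) (n d : nat) (X : pred (os n d.+1)).
Hypothesis d0 : (0 < d)%N.
Hypothesis admX : admissible X.
Variable M : module K n d -> Prop.
Hypothesis MX : forall V, M V <-> in_add X V.
Variable U : torsion_class M.

Definition tors_set : pred (os n d.+1) := [pred x | `[< U (Mx K x) >]].
Local Notation F := tors_set.

Lemma tors_setP x : reflect (U (thin K true x)) (F x).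
Proof. by rewrite -MxE; apply: asboolP. Qed.

Lemma tors_set_sub x : F x -> X x.
Proof. by move/tors_setP/tors_sub/MX/(in_add_thinP _ d0). Qed.

Lemma tors_summand_r V W : U (mod_sum V W) -> U W.
Proof.
move=> UVW; apply: (@tors_summand _ _ _ _ U _ V); apply: tors_iso UVW.
exists (mor_pair (mor_snd V W) (mor_fst V W)), (mor_pair (mor_snd W V) (mor_fst W V)).
by split=> y [a b]; rewrite !mor_pairE !mor_fstE !mor_sndE.
Qed.

Lemma tors_bigsum s : U (mod_bigsum [seq Mx K x | x <- s]) -> all F s.
Proof.
elim: s => //= x s IH Uxs; rewrite IH ?andbT; last exact: tors_summand_r Uxs.
by apply/asboolP; apply: tors_summand Uxs.
Qed.

(** Closure under isomorphisms, sums and summands makes a torsion class the additive closure of its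
    indecomposables. *)
Lemma torsE V : U V <-> in_add F V.
Proof.
split=> [UV|/(in_add_Mx d0)[s sF Vs]].
  have [s sX Vs] := in_add_Mx d0 ((MX _).1 (tors_sub UV)).
  apply: add_Mx_in; exists s => //; apply: tors_bigsum.
  exact: tors_iso Vs UV.
apply: tors_iso (mod_iso_sym Vs) _; elim: s sF {Vs} => [_|x s IH /= /andP[/asboolP Ux /IH]].
  exact: tors_0.
exact: tors_sum.
Qed.

(** The summand is given as [A] with an equation because [Mx] and [thin] are only propositionally
    equal. *)
Lemma bigsum_component (W : module K n d) s (g : mor (mod_bigsum [seq Mx K x | x <- s]) W) z a :
  g z a != 0 -> exists x A (q : mor A (mod_bigsum [seq Mx K x | x <- s])) b,
    [/\ x \in s, A = thin K true x, mor_mono q & g z (q z b) != 0].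
Proof.
elim: s g a => [|x s IH] g a.
  by rewrite ((mod_zeroP _).1 (@mod0_zero K n d) z a) lfun0 eqxx.
set A := Mx K x; set B := mod_bigsum [seq Mx K x | x <- s] in IH * => ga.
have [g1|g1] := eqVneq (g z (mor_inl A B z a.1)) 0; last first.
  exists x, A, (mor_inl A B), a.1; split=> //; [by rewrite inE eqxx|exact: MxE|].
  by apply/mor_monoP => y v; rewrite mor_inlE => -[].
have : mor_comp g (mor_inr A B) z a.2 != 0.
  apply: contra ga => /eqP g2; rewrite mor_compE in g2.
  have -> : a = mor_inl A B z a.1 + mor_inr A B z a.2.
    by rewrite mor_inlE mor_inrE; case: (a) => a1 a2; congr (_, _); rewrite ?addr0 ?add0r.
  by rewrite lfunD g1 g2 addr0.
move=> /IH[x' [A' [q [b [x's A'E /mor_monoP qm gq]]]]].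
exists x', A', (mor_comp (mor_inr A B) q), b; split=> //.
- by rewrite inE x's orbT.
- apply/mor_monoP => y v; rewrite mor_compE mor_inrE => -[]; exact: qm.
- by move: gq; rewrite !mor_compE.
Qed.

(** Injectivity is tested at (x_1, ..., x_d), the lowest vertex in the support of M_x: it must also
    lie in the support of M_y. *)
Lemma mono_thin (x y : os n d.+1) (t : mor (thin K true x) (thin K true y)) : mor_mono t ->
  hom_le x y /\ forall i, (i < d)%N -> ent x i = ent y i.
Proof.
move=> /mor_monoP tm; have [c cE tE] := hom_thin d0 t.
have [i id|z xz zE] := @interlaced_build n d x (ent x).
  by rewrite leqnn ent_le.
have xy : hom_le x y /\ interlaced y z.
  apply: contrapT => nxy; suff : gen true x z = 0 :> thin K true x z.
    by move/eqP; rewrite gen_eq0 /supp xz.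
  apply: tm; rewrite tE; have [->|c0] := eqVneq c 0; first by rewrite mul0r scale0r.
  have [yz|nyz] := boolP (interlaced y z); last by rewrite gen0 ?scaler0.
  by case: nxy; have := cE c0.
case: xy => xy /interlacedP yz; split=> // i id.
have := yz i id; rewrite zE // => /andP[yx _].
by apply/eqP; rewrite eqn_leq yx andbT; have /hom_leP[-> //] := xy; apply: ltnW.
Qed.

(* The submodule of M_y generated by U is some M_x in U, with x_i = y_i for i <= d. *)
Lemma trace_thin (UX : module K n d) (y : os n d.+1) (f : mor UX (thin K true y)) z a :
  U UX -> mor_mono f -> f z a != 0 ->
  exists x, [/\ F x, hom_le x y, forall i, (i < d)%N -> ent x i = ent y i
    & interlaced x z].
Proof.
move=> /torsE/(in_add_Mx d0)[s sF [g [h [gh hg]]]] /mor_monoP fm fa.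
have [|x [A [q [b [xs AE /mor_monoP qm fq]]]]] := @bigsum_component _ s (mor_comp f h) z (g z a).
  by rewrite mor_compE gh.
subst A; have tm : mor_mono (mor_comp (mor_comp f h) q).
  apply/mor_monoP => w v; rewrite !mor_compE => /fm /(congr1 (g w)).
  by rewrite hg lfun0 => /qm.
have [xy xyE] := mono_thin tm; exists x; split=> //; first exact: (allP sF).
apply: contraNT fq => nxz; have [c ->] := genP b.
by rewrite (@gen0 _ _ _ true x z) // scaler0 !lfun0.
Qed.

(** For torsion T, every map T -> W lands in the torsion part of W: its composite with [g] is killed
    by [h], hence zero. *)
Lemma trace_killed (W V0 V1 T : module K n d) (g : mor W V0) (h : mor V0 V1)
    (t : mor T W) :
  exact_at g h ->
  (forall s : mor T V0, (forall y, (h y \o s y)%VF = 0) -> forall y, s y = 0) ->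
  forall y v, g y (t y v) = 0.
Proof.
move=> /exact_atP[hg _] inj y v; rewrite -mor_compE inj ?zero_lfunE // => z.
by apply/lfunP => w; rewrite comp_lfunE mor_compE hg zero_lfunE.
Qed.

(** The map M_x -> M_v lands in the torsion submodule of M_v. At the top vertex of M_x this yields a
    torsion M_w inside M_v whose last entry is at least [ent x d = ent v d], so w = v. *)
Lemma tors_set_hom x v : F x -> hom_le x v -> ent v d = ent x d -> F v.
Proof.
move=> Fx xv vd; have Xv : X v.
  apply: (admX (tors_set_sub Fx)); last by rewrite vd.
  by have /hom_leP[-> //] := xv.
have [UX [V [f [g [h [[_ UUX _ _] [[fm fg gh _] TV]]]]]]] :
  torsion_seq M U (thin K true v) by apply: tors_seq; apply/MX/in_add_thin.
pose t := @can K n d true true x v (fun _ _ => xv).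
have [T0 _] := TV _ (elimT (tors_setP _) Fx).
have [z xz zE] := top_exists x.
have gt := trace_killed t gh T0.
have /exact_atP[_ /(_ _ _ (gt z (gen true x z))) [b bE]] := fg.
have vz : interlaced v z := hom_le_top xv xz zE.
have fb : f z b != 0.
  by rewrite -bE can_gen /supp /= xz scale1r gen_eq0 /supp vz.
have [w [Fw /hom_leP[wv _] wE /interlacedP wz]] := trace_thin UUX fm fb.
suff -> : v = w by [].
apply: entP => i; rewrite ltnS leq_eqVlt => /orP[/eqP ->|id]; last by rewrite wE.
apply/eqP; rewrite eqn_leq wv // andbT vd.
have := wz d.-1; rewrite prednK // => /(_ (leqnn _)) /andP[_].
by rewrite zE ?prednK.
Qed.

(** The entries are raised one at a time from right to left; each new [ent v i] is then bounded by
    the already raised next entry, so each step is a nonzero map. *)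
Lemma tors_set_up x v : F x -> ent v d = ent x d ->
  (forall i, (i < d)%N -> (ent x i <= ent v i)%N) -> F v.
Proof.
move=> Fx vd xv.
suff H m w : (m <= d)%N -> (forall i, (i <= d)%N ->
    ent w i = if (i < d - m)%N then ent x i else ent v i) -> F w.
  by apply: (H d) => // i id; rewrite subnn.
elim: m w => [|m IH] w md wE.
  suff -> : w = x by [].
  apply: entP => i; rewrite ltnS => id; rewrite wE // subn0.
  by case: ltnP => // di; have -> : i = d by lia.
have [|i id|w' w'E] := @os_fun n d.+1 (fun i => if (i < d - m)%N then ent x i else ent v i).
- by move=> i id; have := ent_lt x id; have := ent_lt v id; case: (ltnP i (d - m)) => _.
- case: (ltnP i (d - m)) => im; case: (ltnP i.+1 (d - m)) => im'; try lia.
  + by apply: ent_le.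
  + by have := ent_le v (leqnSn i) id; have := xv i; lia.
  + by apply: ent_le.
have Fw' : F w' by apply: IH => [|i id]; [apply: ltnW|apply: w'E].
apply: (tors_set_hom Fw').
  apply/hom_leP; split=> i id; rewrite w'E // wE //; try lia.
    have := xv i.
    by case: (ltnP i (d - m)) => im; case: (ltnP i (d - m.+1)) => im' => // ?; lia.
  have := xv i; have := ent_le x (leqnSn i); have := ent_le v (leqnSn i).
  by case: (ltnP i (d - m.+1)) => im; case: (ltnP i.+1 (d - m)) => im'; lia.
rewrite w'E // wE //.
by case: (ltnP d (d - m.+1)) => ?; case: (ltnP d (d - m)) => ?; lia.
Qed.

(* [N] is an exact sequence to which morphisms from M_u may be lifted, and y_0 -> ... -> y_d
   are as above: the double complex N_k(y_m) is chased from the corner (0, d-1) to y_0. *)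
Lemma resolution_chase (a : nat -> nat) (u : os n d.+1) (y : nat -> os n d)
    (amono : forall i, (i <= d)%N -> (a i <= a i.+1)%N)
    (uE : forall i, (i <= d)%N -> ent u i = (a i.+1).+1)
    (yE : forall m i, (m <= d)%N -> (i < d)%N ->
       ent (y m) i = if (i < m)%N then a i.+1 else (a i.+2).+1)
    (p : forall m, (m < d)%N -> qpath (y m) (y m.+1))
    (N : nat -> module K n d) (D : forall k, mor (N k) (N k.+1)) :
  (forall k, in_add X (N k)) ->
  (forall k, exact_at (D k) (D k.+1)) ->
  (forall k (t : mor (thin K true u) (N k.+2)),
     (forall z v, D k.+2 z (t z v) = 0) ->
     exists s : mor (thin K true u) (N k.+1), forall z v, t z v = D k.+1 z (s z v)) ->
  forall m (md : (m < d)%N) k (e : N k.+1 (y m)),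
    path_act (N k.+2) (p _ md) (D k.+1 (y m) e) = 0 ->
    exists r s, e = D k (y m) r + s /\ path_act (N k.+1) (p _ md) s = 0.
Proof.
move=> NX DE lift; elim=> [|m IH] md k e pe.
  have uy0 := top_y0 d0 amono uE yE; have topE := y0E uE yE.
  have ndy1 : ~~ interlaced u (y 1%N) := y1_notin d0 uE yE.
  (* The image of [e] under D is killed by the path to [y 1], so it defines a map from M_u. Its lift
     [s] supplies the part of [e] killed by the path, and the rest comes from exactness of [D]. *)
  have [t tE] : exists t : mor (thin K true u) (N k.+2),
      t (y 0%N) (gen true u (y 0%N)) = D k.+1 (y 0%N) e.
    exact: (path_hom amono uE yE (NX k.+2) pe).
  have [/= DD0 DD1] := (exact_atP _ _).1 (DE k.+1).
  have [|s sE] := lift k t.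
    move=> z v; have [c ->] := genP v; rewrite !lfunZ.
    have [uz|nuz] := boolP (interlaced u z); last by rewrite gen0 ?lfun0 ?scaler0.
    have [q ->] := mor_top t uy0 topE uz.
    by rewrite path_nat tE DD0 lfun0 scaler0.
  have [_ DD2] := (exact_atP _ _).1 (DE k).
  have [|r rE] := DD2 _ (e - s (y 0%N) (gen true u (y 0%N))).
    by rewrite lfunB -sE tE subrr.
  exists r, (s (y 0%N) (gen true u (y 0%N))); split; first by rewrite -rE subrK.
  by rewrite -path_nat path_gen (@gen0 _ _ _ true u (y 1%N)) // scaler0 lfun0.
(* The image of [e] under D comes from some [e1] at the previous vertex; the induction hypothesis
   for [k.+1] splits [e1], and the path image of [r] is the part of [e] to subtract. *)
have [e1 e1E] := path_exact d0 amono yE (NX k.+2) (ltnW md) pe.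
have [DD0 _] := (exact_atP _ _).1 (DE k.+1).
have [|r [s [rs ps]]] := IH (ltnW md) k.+1 e1.
  by rewrite -path_nat -e1E DD0.
have [_ DD2] := (exact_atP _ _).1 (DE k).
have [|r' r'E] := DD2 _ (e - path_act (N k.+1) (p _ (ltnW md)) r).
  by rewrite lfunB e1E rs lfunD ps addr0 path_nat subrr.
exists r', (path_act (N k.+1) (p _ (ltnW md)) r); split; first by rewrite -r'E subrK.
by rewrite (path_complex d0 yE p (NX k.+1) md _ r).
Qed.

(** The case of the extension condition in which M_u fits the projective resolution with a = (x',
    [ent x d] - 1). The chase shows that the vector of M_x at y_(d-1) lies in the torsion submodule,
    which must then have last entry [ent x d]. *)
Lemma tors_set_ext1 x x' u : F x' -> F u -> X x ->
  (forall i, (i < d)%N -> ent x' i = ent x i) -> (ent x' d < ent x d)%N ->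
  (forall i, (i < d)%N -> ent u i = (ent x' i.+1).+1) -> ent u d = ent x d -> F x.
Proof.
move=> Fx' Fu Xx x'E x'd uE0 ud.
pose a i := if (i <= d)%N then ent x' i else (ent x d).-1.
have aE i : (i <= d)%N -> a i = ent x' i by rewrite /a => ->.
have ad1 : a d.+1 = (ent x d).-1 by rewrite /a ltnn.
have amono i : (i <= d)%N -> (a i <= a i.+1)%N.
  rewrite leq_eqVlt => /orP[/eqP ->|id]; first by rewrite aE // ad1; lia.
  by rewrite !aE // ?ent_le // ltnW.
have uE i : (i <= d)%N -> ent u i = (a i.+1).+1.
  rewrite leq_eqVlt => /orP[/eqP ->|id]; first by rewrite ad1 ud prednK //; lia.
  by rewrite uE0 // aE.
have /choice [y yE0] : forall m, exists z : os n d, (m <= d)%N -> forall i, (i < d)%N ->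
    ent z i = if (i < m)%N then a i.+1 else (a i.+2).+1.
  (* The cap by [ent x d] is inactive for the indices in range; it gives the bound by [n]. *)
  move=> m; have [i id|i id|z zE] :=
    @os_fun n d (fun i => if (i < m)%N then a i.+1 else minn (a i.+2).+1 (ent x d)).
  - have := ent_lt x (leqnn d.+1); have := ent_lt x' (i := i.+1) id.
    by rewrite -aE //; case: (ltnP i m) => _; lia.
  - have := amono i.+1; have := amono i.+2; have := amono i.+3.
    have : (a i.+2 < ent x d)%N by rewrite aE // (leq_ltn_trans _ x'd) // ent_le.
    by case: (ltnP i m) => im; case: (ltnP i.+1 m) => im'; lia.
  exists z => md i id; rewrite zE //; case: ltnP => // mi.
  have : (a i.+2 < ent x d)%N; last by lia.
  have [di|di] := leqP i.+2 d; first by rewrite aE // (leq_ltn_trans _ x'd) // ent_le.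
  by have -> : i.+2 = d.+1 by [lia]; rewrite ad1 prednK //; lia.
have yE m i : (m <= d)%N -> (i < d)%N ->
    ent (y m) i = if (i < m)%N then a i.+1 else (a i.+2).+1 by move=> md; apply: yE0.
have yle m : (m < d)%N -> forall i, (i < d)%N -> (ent (y m.+1) i <= ent (y m) i)%N.
  move=> md i id; rewrite !yE //; last exact: ltnW.
  by have := amono i.+1 id; case: (ltnP i m.+1) => im; case: (ltnP i m) => im'; lia.
pose p m (md : (m < d)%N) := dpath (yle m md).
have hx'x : hom_le x' x.
  apply/hom_leP; split=> i id; last by rewrite -x'E ?ent_le.
  move: id; rewrite ltnS leq_eqVlt => /orP[/eqP ->|id]; first exact: ltnW.
  by rewrite x'E.
have [UX [V [f [g [h [[MUX UUX MV _] [[fm fg gh hh] TV]]]]]]] :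
  torsion_seq M U (thin K true x) by apply: tors_seq; apply/MX/in_add_thin.
pose t := @can K n d true true x' x (fun _ _ => hx'x).
have gt := trace_killed t gh (TV _ (elimT (tors_setP _) Fx')).1.
pose N k := match k with 0 => UX | 1 => thin K true x | k.+2 => V k end.
pose D k : mor (N k) (N k.+1) :=
  match k with 0 => f | 1 => g | k.+2 => h k end.
have NX k : in_add X (N k).
  by case: k => [|[|k]]; [apply/MX|apply: in_add_thin|apply/MX/MV].
have DE k : exact_at (D k) (D k.+1) by case: k => [|[|k]]; [exact: fg|exact: gh|exact: hh].
have lift k (s : mor (thin K true u) (N k.+2)) :
    (forall z v, D k.+2 z (s z v) = 0) ->
    exists r : mor (thin K true u) (N k.+1), forall z v, s z v = D k.+1 z (r z v).
  move=> s0; have [T0 T1] := TV _ (elimT (tors_setP _) Fu).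
  have s0' z : (D k.+2 z \o s z)%VF = 0.
    by apply/lfunP => v; rewrite comp_lfunE s0 zero_lfunE.
  case: k s s0 s0' => [|k] s s0 s0'.
    exists (mor0 _ _) => z v; rewrite mor0E lfun0.
    by have /lfunP/(_ v) := T0 s s0' z; rewrite zero_lfunE.
  have [r rE] := T1 k s s0'; exists r => z v.
  by have /lfunP/(_ v) := rE z; rewrite comp_lfunE.
have d1 : (d.-1 < d)%N by rewrite prednK.
have dd : d.-1.+1 = d by apply: prednK.
have xy1 : interlaced x (y d.-1).
  apply/interlacedP => i id; rewrite yE //; last exact: ltnW.
  have [i1|i1] := ltnP i d.-1.
    have i2 : (i.+1 < d)%N by rewrite -dd ltnS.
    by rewrite aE // x'E // leqnn ent_le // ltnW.
  have -> : i = d.-1 by lia.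
  rewrite dd ad1 prednK; last by lia.
  by rewrite leqnn ent_le // ltnW.
have x'yd : interlaced x' (y d).
  by apply/interlacedP => i id; rewrite yE // id aE // leqnn ent_le.
(* Corner [k = 0], [m = d.-1]. At [y d] the generator of M_x is the image of that of M_x', which is
   torsion, so [g] kills it. *)
have [] := resolution_chase amono uE yE (p := p) NX DE lift (md := d1) (k := 0%N)
  (e := gen true x (y d.-1)).
  rewrite -path_nat path_gen lfunZ.
  suff -> : D 1%N (y d.-1.+1) (gen true x (y d.-1.+1)) = 0 by rewrite scaler0.
  rewrite dd; have := gt (y d) (gen true x' (y d)).
  by rewrite can_gen /supp /= x'yd scale1r.
move=> r [s [rs ps]].
(* M_x is supported at both [y d.-1] and [y d], so the path between them acts injectively. *)
have s0 : s = 0.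
  have [c sE] := genP s; have xs1 : supp true x (y d.-1) by rewrite /supp xy1.
  move: ps; rewrite sE lfunZ path_gen xs1 scale1r.
  move/eqP; rewrite scaler_eq0 gen_eq0 => /orP[/eqP ->|]; first by rewrite scale0r.
  rewrite dd /supp => /negP[]; apply/interlacedP => i id.
  rewrite yE // id aE // -(x'E i id) ent_le //=.
  by have /hom_leP[-> //] := hx'x.
rewrite s0 addr0 in rs.
have fr : f (y d.-1) r != 0.
  by move: rs => /= <-; rewrite gen_eq0 /supp xy1.
have [w [Fw /hom_leP[wx _] wE /interlacedP wy]] := trace_thin UUX fm fr.
suff -> : x = w by [].
apply: entP => i; rewrite ltnS leq_eqVlt => /orP[/eqP ->|id]; last by rewrite wE.
apply/eqP; rewrite eqn_leq wx // andbT.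
have := wy d.-1 d1; rewrite yE ?(ltnW d1) // ltnn dd ad1 prednK; last by lia.
by case/andP.
Qed.

(** Induction on the position [m] from which [x] is constant, equal to [ent x' d]. For [m = 0] the
    sequence [w] itself has the form required by [tors_set_ext1]; for [m = d] the constancy
    condition is void. *)
Lemma tors_set_ext m x x' w : F x' -> F w -> X x ->
  (forall i, (i < d)%N -> ent x' i = ent x i) -> (ent x' d < ent x d)%N ->
  (forall i, (i < d)%N -> ent w i = (ent x' d).+1) -> ent w d = ent x d ->
  (m <= d)%N -> (forall i, (m <= i < d)%N -> ent x i = ent x' d) -> F x.
Proof.
elim: m x x' => [|m IH] x x' Fx' Fw Xx x'E x'd wE wd md xm.
  apply: (tors_set_ext1 Fx' Fw Xx x'E x'd _ wd) => i id; rewrite wE //.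
  have [id'|di] := ltnP i.+1 d; first by rewrite (x'E i.+1) // xm.
  by have -> : i.+1 = d by lia.
(* Dropping the first entry of [x'] and repeating its last one gives [y'], torsion by raising. Its
   extension [y] is constant one position earlier, hence torsion by induction, and raising [y] gives
   the [u] for [tors_set_ext1]. *)
have [i id|i id|y' y'E] := @os_fun n d.+1 (fun i => if (i < d)%N then ent x' i.+1 else ent x' d).
- by case: (ltnP i d) => [id'|_]; apply: ent_lt.
- case: (ltnP i.+1 d) => id'; first by rewrite (ltnW id') ent_le.
  by case: (ltnP i d) => id2 //; apply: ent_le.
have [|y [yE yd]] := @os_with_last n d y' (ent x d) d0.
  rewrite ent_lt // andbT y'E ?(leq_trans (leq_pred d)) // prednK //.
  by rewrite leqnn ltnW.
have y'd : ent y' d = ent x' d by rewrite y'E // ltnn.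
have y'i i : (i < d)%N -> ent y' i = ent x' i.+1 by move=> id; rewrite y'E ?id // ltnW.
have Fy : F y.
  apply: (IH y y') => //.
  - by apply: (tors_set_up Fx') => // i id; rewrite y'i // ent_le.
  - apply: (admX Xx); last by rewrite yd.
    by rewrite yE // y'i // -x'E // ent_le.
  - by move=> i id; rewrite yE.
  - by rewrite y'd yd.
  - by move=> i id; rewrite y'd wE.
  - by rewrite yd.
  - exact: ltnW.
  move=> i /andP[mi id]; rewrite yE // y'i // y'd.
  have [id'|di] := ltnP i.+1 d; first by rewrite x'E // xm // ltnS mi.
  by have -> : i.+1 = d by lia.
have [i id|i id|u uE] := @os_fun n d.+1 (fun i => if (i < d)%N then (ent x' i.+1).+1 else ent x d).
- case: (ltnP i d) => [id'|_]; last exact: ent_lt.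
  apply: leq_ltn_trans (ent_lt x (leqnn d.+1)); apply: leq_trans x'd.
  by rewrite ltnS ent_le.
- case: (ltnP i.+1 d) => id'; first by rewrite (ltnW id') ltnS ent_le // ltnW.
  case: (ltnP i d) => id2 //; apply: leq_trans x'd; by rewrite ltnS ent_le.
apply: (tors_set_ext1 (u := u) Fx' _ Xx x'E x'd).
- apply: (tors_set_up Fy); first by rewrite uE // ltnn yd.
  by move=> i id; rewrite yE // y'i // uE ?id ?leqnSn // ltnW.
- by move=> i id; rewrite uE ?id // ltnW.
- by rewrite uE // ltnn.
Qed.

Lemma tors_set_closed : tors_closed X F.
Proof.
split=> [x|x v|x w v Fx Fw xw wE vE vd Xv]; [exact: tors_set_sub|exact: tors_set_up|].
apply: (@tors_set_ext d v x w) => //.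
- by move=> i id; rewrite vE.
- by rewrite vd.
- by move=> i; rewrite ltnNge andbC andNb.
Qed.

End Necessity.

(** * Join-semidistributivity *)

Section TamariJoinSemidistributive.
Variables (dP : Order.disp_t) (P : finBPOrderType dP) (phi : bot_chain P).
Implicit Types F G H N : Tam phi.

Lemma tam_leE F G : (F <= G)%O = (val F \subset val G).
Proof. by []. Qed.

Lemma tam_up F x y k : (x, k) \in val F -> (x <= y)%O -> (y <= chain_at phi k)%O ->
  (y, k) \in val F.
Proof.
have [_ uF _] := torclosed_filterP _ (valP F).
by move=> xF xy yk; apply: uF xF xy _; rewrite inE.
Qed.

Lemma tam_ext F x (i j : 'I_(size phi)) : (i < j)%N -> (x, i) \in val F ->
  (chain_at phi i.+1, j) \in val F -> (x, j) \in val F.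
Proof. by have [_ _ cF] := torclosed_filterP _ (valP F); apply: cF. Qed.

Lemma tam_carrierP F x k : (x, k) \in val F -> (x <= chain_at phi k)%O.
Proof. by have [/subsetP sF _ _] := torclosed_filterP _ (valP F); move/sF; rewrite inE. Qed.

Lemma chain_le (i j : nat) : (i <= j)%N -> (j < size phi)%N ->
  (chain_at phi i <= chain_at phi j)%O.
Proof.
rewrite leq_eqVlt => /orP[/eqP -> //|ij] js; apply/ltW.
by apply: (sorted_ltn_nth lt_trans \bot%O (chain_lt phi)); rewrite ?inE // (ltn_trans ij).
Qed.

(* If not, F v G minus the elements (y, j) with y <= x would be torclosed and contain F and G. *)
Lemma tam_join_generator F G N x (j : 'I_(size phi)) :
  (F <= N)%O ->
  (forall (i : 'I_(size phi)) y, (i < j)%N -> (y, i) \in val (F `|` G)%O -> (y, i) \in val N) ->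
  (forall i : nat, (i < j)%N -> (chain_at phi i.+1, j) \in val (F `|` G)%O ->
     ~~ (chain_at phi i.+1 <= x)%O -> (chain_at phi i.+1, j) \in val N) ->
  (x, j) \in val (F `|` G)%O -> ((x, j) \in val G) || ((x, j) \in val N).
Proof.
move=> FN low chn xw; apply/negPn/negP; rewrite negb_or => /andP[xG xN].
have [Fw Gw] : (F <= F `|` G)%O /\ (G <= F `|` G)%O by rewrite leUl leUr.
have wle H : (F <= H)%O -> (G <= H)%O -> (F `|` G <= H)%O by move=> FH GH; rewrite leUx FH.
move: (F `|` G)%O Fw Gw wle low chn xw => w Fw Gw wle low chn xw.
have xj := tam_carrierP xw.
pose T := [set p in val w | ~~ ((p.2 == j) && (p.1 <= x)%O)].
have Tclosed : torclosed_filter T.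
  apply/torclosed_filterP; split.
  - by apply/subsetP => -[y k]; rewrite !inE /= => /andP[yw _]; exact: tam_carrierP yw.
  - move=> y z k; rewrite !inE /= => /andP[yw ny] yz zk.
    rewrite (tam_up yw yz zk) /=; apply: contra ny => /andP[-> zx].
    exact: le_trans yz zx.
  (* If closure produced a removed element (y, j), its two sources would lie in N, hence so would
     (y, j) and then (x, j), against [xN]. *)
  move=> y i k ik; rewrite !inE /= => /andP[yw _] /andP[cw nc].
  rewrite (tam_ext ik yw cw) /=; apply/negP => /andP[/eqP kj yx]; subst k.
  rewrite eqxx /= in nc; case/negP: xN.
  by apply: tam_up yx xj; apply: tam_ext ik (low _ _ ik yw) (chn _ ik cw nc).
have wT : (w <= (exist _ T Tclosed : Tam phi))%O.
  apply: wle; rewrite tam_leE /=; apply/subsetP => -[y k] yF; rewrite inE /=.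
    have -> /= : (y, k) \in val w by apply: (subsetP Fw).
    apply/negP => /andP[/eqP kj yx]; subst k; case/negP: xN.
    exact: (subsetP FN) _ (tam_up yF yx xj).
  have -> /= : (y, k) \in val w by apply: (subsetP Gw).
  apply/negP => /andP[/eqP kj yx]; subst k; case/negP: xG.
  exact: tam_up yF yx xj.
by have := subsetP wT _ xw; rewrite inE /= eqxx lexx andbF.
Qed.

(** Since w is both joins, [tam_join_generator] puts an element of w outside N in G and in H alike,
    hence in their meet, which is contained in N. The hypotheses of that lemma are met by induction
    on the component [j], and within it along the chain. *)
Lemma tam_join_semidistributive : join_semidistributive (Tam phi).
Proof.
move=> F G H FGH; apply/le_anti/andP; split.
  by rewrite leU2 // leIl.
set N := (F `|` (G `&` H))%O; set w := (F `|` G)%O.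
have FN : (F <= N)%O by apply: leUl.
have GHN p : p \in val G -> p \in val H -> p \in val N.
  move=> pG pH; have GHle : ((G `&` H) <= N)%O by apply: leUr.
  by apply: (subsetP GHle); rewrite inE pG pH.
suff low m (j : 'I_(size phi)) y : (j < m)%N -> (y, j) \in val w -> (y, j) \in val N.
  by rewrite tam_leE; apply/subsetP => -[y j]; apply: (low j.+1).
elim: m j y => // m IH j y; rewrite ltnS => jm yw.
have low (i : 'I_(size phi)) z : (i < j)%N -> (z, i) \in val w -> (z, i) \in val N.
  by move=> ij; apply: IH; apply: leq_trans ij jm.
have gen x : (forall i : nat, (i < j)%N -> (chain_at phi i.+1, j) \in val w ->
     ~~ (chain_at phi i.+1 <= x)%O -> (chain_at phi i.+1, j) \in val N) ->
    (x, j) \in val w -> (x, j) \in val N.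
  move=> chn xw; have [//|xN] := boolP ((x, j) \in val N).
  have := tam_join_generator FN low chn xw; rewrite (negbTE xN) orbF => xG.
  have := @tam_join_generator F H N x j FN; rewrite -FGH => /(_ low chn xw).
  by rewrite (negbTE xN) orbF => xH; rewrite (GHN _ xG xH) in xN.
(* Descending induction on [i]: membership of phi(i) only calls for elements phi(i'+1) not below
   phi(i), hence with i'+1 > i. *)
have chn r i : (i <= j)%N -> (j - i < r)%N -> (chain_at phi i, j) \in val w ->
    (chain_at phi i, j) \in val N.
  elim: r i => // r IHr i ij jir; apply: gen => i' i'j cw nle.
  apply: IHr => //; have : (i < i'.+1)%N; last by lia.
  rewrite ltnNge; apply: contra nle => ii'; apply: chain_le => //.
  by apply: leq_ltn_trans ij _.
by apply: gen => // i ij cw _; apply: (chn (j - i.+1).+1).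
Qed.

End TamariJoinSemidistributive.

(** * Join-semidistributivity passes to finite quotients *)

Section QuotientJoinSemidistributive.
Local Open Scope quotient_scope.
Variables (disp : Order.disp_t) (L : finLatticeType disp) (c : congruence L).

Lemma lquot_eq x y : (\pi_(lquot c) x == \pi_(lquot c) y) = c x y.
Proof. by rewrite pi_eq_quot. Qed.

Lemma lquotI x y : (\pi_(lquot c) x `&` \pi_(lquot c) y)%O = \pi_(lquot c) (x `&` y)%O.
Proof. exact: lquot_meetE. Qed.

Lemma lquotU x y : (\pi_(lquot c) x `|` \pi_(lquot c) y)%O = \pi_(lquot c) (x `|` y)%O.
Proof. exact: lquot_joinE. Qed.

Lemma lquot_leE x y : (\pi_(lquot c) x <= \pi_(lquot c) y)%O = c (x `&` y)%O x.
Proof. by rewrite leEmeet lquotI lquot_eq. Qed.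

(* Meet the given elements with a minimal element w of the class of their joins: both joins
   become equal to w. *)
Lemma lquot_join_semidistributive :
  join_semidistributive L -> join_semidistributive (lquot c).
Proof.
move=> jsd a b e; case: (lquotP a) (lquotP b) (lquotP e) => x -> [y ->] [z ->].
rewrite lquotI !lquotU => /eqP; rewrite lquot_eq => yz; apply/eqP; rewrite lquot_eq.
pose p := (x `|` y)%O.
case: (@arg_minnP _ p (fun t => c t p) (fun t => #|[set s | (s <= t)%O]|) (cong_refl c p)).
move=> w wp wmin.
have minw t : (t <= w)%O -> c t w -> t = w.
  move=> tw ct; apply/eqP/negPn/negP => ntw.
  have := wmin t (cong_trans ct wp); rewrite leqNgt => /negP; apply; apply: proper_card.
  apply/properP; split; last by exists w; rewrite inE ?lexx //; apply: contra ntw => wt; rewrite eq_le tw.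
  by apply/subsetP => s; rewrite !inE => /le_trans; apply.
have meetw t q : (t <= q)%O -> c q p -> c (t `&` w)%O t.
  move=> tq qp; rewrite -{2}(meet_l tq); apply: cong_meet; first exact: cong_refl.
  by apply: cong_trans wp _; rewrite cong_sym.
have joinw t : c (x `|` t)%O p -> ((x `&` w) `|` (t `&` w))%O = w.
  move=> xt; apply: minw; first by rewrite leUx !leIr.
  apply: (@cong_trans _ _ c (x `|` t)%O).
    by apply: cong_join; [apply: meetw xt; apply: leUl|apply: meetw xt; apply: leUr].
  by apply: cong_trans xt _; rewrite cong_sym.
have yw := joinw y (cong_refl c p); have zw : ((x `&` w) `|` (z `&` w))%O = w.
  by apply: joinw; rewrite cong_sym.
have := jsd (x `&` w)%O (y `&` w)%O (z `&` w)%O; rewrite yw zw => /(_ erefl) E.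
have := cong_refl c w; rewrite -{1}E => cE.
apply: cong_trans (cong_trans _ cE) wp; rewrite cong_sym; apply: cong_join.
  by apply: meetw (cong_refl c p); apply: leUl.
have -> : ((y `&` w) `&` (z `&` w) = (y `&` z) `&` w)%O by rewrite meetACA meetxx.
apply: meetw (cong_refl c p).
by apply: le_trans (leIl _ _) (leUr _ _).
Qed.

End QuotientJoinSemidistributive.

(** * The lattices of torsion classes *)

(** The shift [n.+1] guarantees a bottom element, the constant sequence 0; the separate name carries
    the order instances. *)
Definition os_poset (n d : nat) := os n.+1 d.

HB.instance Definition _ n d := Finite.on (os_poset n d).

Section ComponentwiseOrder.
Variables n d : nat.
Implicit Types x y z : os_poset n d.

Definition os_le x y : bool := [forall i : 'I_d, ent x i <= ent y i]%N.

Lemma os_leP x y : reflect (forall i, (i < d)%N -> (ent x i <= ent y i)%N) (os_le x y).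
Proof.
apply: (iffP forallP) => [H i id|H i]; last exact: H.
exact: (H (Ordinal id)).
Qed.

Fact os_le_refl : reflexive os_le.
Proof. by move=> x; apply/os_leP. Qed.
Fact os_le_anti : antisymmetric os_le.
Proof.
move=> x y /andP[/os_leP xy /os_leP yx]; apply: entP => i id.
by apply/eqP; rewrite eqn_leq xy ?yx.
Qed.
Fact os_le_trans : transitive os_le.
Proof.
move=> y x z /os_leP xy /os_leP yz; apply/os_leP => i id.
exact: leq_trans (xy i id) (yz i id).
Qed.

Fact os_disp : Order.disp_t. Proof. exact: Order.Disp tt tt. Qed.

HB.instance Definition _ := Order.Le_isPOrder.Build os_disp (os_poset n d)
  os_le_refl os_le_anti os_le_trans.

Lemma os_const_subproof k : exists y : os_poset n d,
  forall i, (i < d)%N -> ent y i = minn k n.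
Proof. by apply: os_fun => // i _; rewrite ltnS geq_minr. Qed.

Definition os_const k : os_poset n d := sval (cid (os_const_subproof k)).

Lemma os_constE k i : (k <= n)%N -> (i < d)%N -> ent (os_const k) i = k.
Proof.
move=> kn id; rewrite /os_const; case: cid => y /= ->//.
exact/minn_idPl.
Qed.

Fact os_bottom x : (os_const 0 <= x)%O.
Proof. by apply/os_leP => i id; rewrite os_constE. Qed.

HB.instance Definition _ := Order.hasBottom.Build os_disp (os_poset n d) os_bottom.

Hypothesis d0 : (0 < d)%N.

Fact const_chain_head : ohead (mkseq os_const n.+1) = Some \bot%O.
Proof. by []. Qed.

Fact const_chain_lt : sorted <%O (mkseq os_const n.+1).
Proof.
apply/(sortedP \bot%O) => i; rewrite size_mkseq ltnS => id.
rewrite !nth_mkseq ?ltnS //; last exact: ltnW.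
rewrite lt_neqAle; apply/andP; split.
  apply/eqP => /(congr1 (fun x : os_poset n d => ent x 0)).
  by rewrite !os_constE // ?[(i <= n)%N]ltnW // => /eqP; rewrite ltn_eqF.
by apply/os_leP => j jd; rewrite !os_constE // ltnW.
Qed.

Definition const_chain : bot_chain (os_poset n d) :=
  BotChain const_chain_head const_chain_lt.

End ComponentwiseOrder.

(** * Torclosed filters as closed subsets of os_n^(d+1) *)

Section TamariCorrespondence.
Variables n d : nat.
Hypothesis d0 : (0 < d)%N.
Local Notation P := (os_poset n d).
Local Notation phi := (const_chain n d0).
Implicit Types (x v w : os n.+1 d.+1) (X F : pred (os n.+1 d.+1)) (T : Tam phi).

Lemma size_const_chain : size phi = n.+1.
Proof. exact: size_mkseq. Qed.

Lemma chain_atE k : (k <= n)%N -> chain_at phi k = os_const n d k.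
Proof. by move=> kn; rewrite /chain_at nth_mkseq. Qed.

Lemma os_init_subproof x : exists y : P, forall i, (i < d)%N -> ent y i = ent x i.
Proof.
apply: os_fun => i id; first by apply: ent_lt; apply: ltnW.
by apply: ent_le => //; apply: ltnW.
Qed.

Definition os_init x : P := sval (cid (os_init_subproof x)).

Lemma os_initE x i : (i < d)%N -> ent (os_init x) i = ent x i.
Proof. by move=> id; rewrite /os_init; case: cid => y /= ->. Qed.

Lemma os_last_subproof x : (ent x d < size phi)%N.
Proof. by rewrite size_const_chain ent_lt. Qed.

Definition os_last x : 'I_(size phi) := Ordinal (os_last_subproof x).

(** A bijection onto the carrier of [Tam phi]: y followed by k is non-decreasing iff y <= (k, ...,
    k) = phi(k). *)
Definition os_split x : P * 'I_(size phi) := (os_init x, os_last x).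

Lemma os_split_inj : injective os_split.
Proof.
move=> x v E; have /= xv := congr1 fst E; have /= l := congr1 (fun p => val p.2) E.
apply: entP => i; rewrite ltnS leq_eqVlt => /orP[/eqP -> //|id].
by rewrite -!os_initE // xv.
Qed.

Lemma ord_chain_le (k : 'I_(size phi)) : (k <= n)%N.
Proof. by rewrite -ltnS (leq_trans (ltn_ord k)) ?size_const_chain. Qed.

Lemma os_split_carrier x : (os_init x <= chain_at phi (os_last x))%O.
Proof.
rewrite chain_atE ?ord_chain_le //; apply/os_leP => i id.
rewrite os_initE // os_constE //=; first by rewrite ent_le // ltnW.
by have := ent_lt x (ltnSn d).
Qed.

Lemma os_splitP (y : P) (k : 'I_(size phi)) : (y <= chain_at phi k)%O ->
  exists x, os_split x = (y, k).
Proof.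
have kn := ord_chain_le k; rewrite chain_atE // => /os_leP yk.
have [i id|i id|x xE] := @os_fun n.+1 d.+1 (fun i => if (i < d)%N then ent y i else k).
- by case: (ltnP i d) => [id'|_]; [apply: ent_lt|rewrite ltnS].
- case: (ltnP i.+1 d) => id'; first by rewrite (ltnW id') ent_le.
  by case: (ltnP i d) => id2 //; have := yk i id2; rewrite os_constE.
exists x; congr (_, _).
  by apply: entP => i id; rewrite os_initE // xE ?id // ltnW.
by apply: val_inj; rewrite /= xE // ltnn.
Qed.

Definition tam_pred T : pred (os n.+1 d.+1) := [pred w | os_split w \in val T].

(** As phi(i+1) is the constant sequence i+1, the torclosed condition becomes the extension
    condition of [tors_closed]; intersecting with X keeps it because that condition asks for its
    conclusion only in X. *)
Lemma tam_pred_closed X T : admissible X -> tors_closed X [pred w | X w && tam_pred T w].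
Proof.
move=> admX; split=> [x /andP[]//|x v /andP[Xx xT] vd xv|x w v].
  apply/andP; split.
    by apply: (admX _ _ Xx); rewrite ?vd // xv.
  have E : os_last v = os_last x by apply: val_inj.
  rewrite /tam_pred /= /os_split E; apply: tam_up xT _ _.
    by apply/os_leP => i id; rewrite !os_initE ?xv.
  by rewrite -E os_split_carrier.
move=> /andP[_ xT] /andP[_ wT] xw wE vE vd Xv; rewrite /= Xv /tam_pred /=.
have E : os_last v = os_last w by apply: val_inj.
have E' : os_init v = os_init x by apply: entP => i id; rewrite !os_initE ?vE.
rewrite /os_split E E'; apply: (@tam_ext _ _ _ T _ (os_last x)) => //.
have xn : ((ent x d).+1 <= n)%N by have := ent_lt w (ltnSn d); lia.
suff -> : chain_at phi (os_last x).+1 = os_init w by [].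
rewrite chain_atE //; apply: entP => i id.
by rewrite os_constE // os_initE // wE.
Qed.

Definition tam_of_set F : {set P * 'I_(size phi)} := os_split @: [set w | F w].

Lemma mem_tam_of_set F w : (os_split w \in tam_of_set F) = F w.
Proof. by rewrite mem_imset ?inE //; apply: os_split_inj. Qed.

Lemma tam_of_setP F : tors_closed predT F -> torclosed_filter (tam_of_set F).
Proof.
case=> _ Fup Fext; apply/torclosed_filterP; split.
- by apply/subsetP => _ /imsetP[w _ ->]; rewrite inE os_split_carrier.
- move=> x y k + xy; rewrite inE /= => + yk.
  have [v vE] := os_splitP yk; rewrite -vE mem_tam_of_set => /imsetP[w].
  rewrite inE => Fw [xE kE]; apply: Fup Fw _ _.
    by have /(congr1 (fun p => val p.2)) /= -> := vE; rewrite kE.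
  move=> i id; rewrite -(os_initE v id) -(os_initE w id) -xE.
  by have -> : os_init v = y by [case: vE]; move/os_leP: xy; apply.
move=> x i j ij /imsetP[w + wE]; rewrite inE => Fw /imsetP[w' + w'E]; rewrite inE => Fw'.
have wx : os_init w = x by case: wE.
have wi : ent w d = i by case: wE => _ ->.
have w'c : os_init w' = chain_at phi i.+1 by case: w'E.
have w'j : ent w' d = j by case: w'E => _ ->.
have ijn : (i < n)%N by apply: leq_trans ij (ord_chain_le j).
have xj : (x <= chain_at phi j)%O.
  rewrite chain_atE ?ord_chain_le //; apply/os_leP => k kd.
  rewrite os_constE ?ord_chain_le // -wx os_initE // (leq_trans (ent_le w (ltnW kd) _)) //.
  by rewrite wi ltnW.
have [v vE] := os_splitP xj; rewrite -vE mem_tam_of_set.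
apply: (Fext w w') => //.
- by rewrite wi w'j.
- by move=> k kd; rewrite -os_initE // w'c chain_atE // os_constE // wi.
- move=> k kd; rewrite -(os_initE v kd) -(os_initE w kd) wx.
  by have -> : os_init v = x by case: vE.
- by rewrite w'j; have /(congr1 (fun p => val p.2)) /= -> := vE.
Qed.

Definition tam_of F (FC : tors_closed predT F) : Tam phi :=
  exist (@torclosed_filter _ _ phi) _ (tam_of_setP FC).

Lemma tam_ofE F (FC : tors_closed predT F) w : tam_pred (tam_of FC) w = F w.
Proof. exact: mem_tam_of_set. Qed.

Lemma tam_pred_leP T T' : (T <= T')%O <-> forall w, tam_pred T w -> tam_pred T' w.
Proof.
split=> [/subsetP TT' w|TT']; first exact: TT'.
rewrite tam_leE; apply/subsetP => -[y k] yT.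
by have [w wE] := os_splitP (tam_carrierP yT); rewrite -wE in yT *; apply: TT'.
Qed.

(** * Restriction to an admissible set is a lattice congruence *)

Section Restriction.
Variable X : pred (os n.+1 d.+1).
Hypothesis admX : admissible X.

(* The largest closed set whose intersection with X is contained in H. *)
Definition cofree (H : pred (os n.+1 d.+1)) : pred (os n.+1 d.+1) :=
  [pred w | [forall v : os n.+1 d.+1,
     [&& X v, ent v d == ent w d & [forall i : 'I_d, ent w i <= ent v i]%N] ==> H v]].

Lemma cofreeP (H : pred (os n.+1 d.+1)) w : reflect
  (forall v, X v -> ent v d = ent w d -> (forall i, (i < d)%N -> (ent w i <= ent v i)%N) -> H v)
  (cofree H w).
Proof.
apply: (iffP forallP) => [Hw v Xv vd wv|Hw v].
  have := Hw v; rewrite Xv vd eqxx /=; move/implyP; apply.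
  by apply/forallP => i; apply: wv.
apply/implyP => /and3P[Xv /eqP vd /forallP wv]; apply: Hw => // i id.
exact: (wv (Ordinal id)).
Qed.

(** For the extension condition, let y in X lie above v with the same last entry. If
    [ent x d < ent y 0] then y lies above w already; otherwise y is reached from an extension inside
    X. *)
Lemma cofree_closed (H : pred (os n.+1 d.+1)) : tors_closed X H -> tors_closed predT (cofree H).
Proof.
case=> HX Hup Hext; split=> // [x v /cofreeP Hx vd xv|x w v /cofreeP Hx /cofreeP Hw].
  apply/cofreeP => y Xy yd vy; apply: Hx => //; first by rewrite yd.
  by move=> i id; apply: leq_trans (xv i id) (vy i id).
move=> xw wE vE vd _; apply/cofreeP => y Xy yd vy.
have [yx|yx] := ltnP (ent x d) (ent y 0).
  apply: Hw => //; first by rewrite yd.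
  by move=> i id; rewrite wE // (leq_trans yx) // ent_le // ltnW.
(* Capping [y] at [ent x d] gives a [z] above [x] with the same last entry, so [H z]. Its extension
   [z'] by [w] ends in [ent y d] and lies below [y]; admissibility keeps [z], [w] and [z'] in X. *)
have [i id|i id|z zE] := @os_fun n.+1 d.+1 (fun i => minn (ent y i) (ent x d)).
- by rewrite gtn_min ent_lt.
- by have := ent_le y (leqnSn i) id; lia.
have zd : ent z d = ent x d by rewrite zE //; apply/minn_idPr; rewrite yd vd ltnW.
have zi i : (i < d)%N -> ent z i = minn (ent y i) (ent x d).
  by move=> id; rewrite zE // ltnW.
have y0z : (ent y 0 <= ent z 0)%N by rewrite zi //; lia.
have Hz : H z.
  apply: Hx => //; first by apply: (admX Xy) => //; rewrite zd yd vd ltnW.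
  by move=> i id; rewrite zi // leq_min -vE // vy // vE // ent_le // ltnW.
have [|z' [z'E z'd]] := @os_with_last n.+1 d z (ent y d) d0.
  rewrite ent_lt // andbT zi ?prednK //.
  by rewrite (leq_trans (geq_minl _ _)) // ent_le // leq_pred.
have Xz' : X z' by apply: (admX Xy); rewrite ?z'd // z'E.
have Xw : X w.
  by apply: (admX Xy); rewrite ?yd ?vd // wE // ltnW.
have Hz' : H z'.
  apply: (Hext z w) => //; first by apply: Hw.
  - by rewrite zd.
  - by move=> i id; rewrite zd wE.
  - by rewrite z'd yd.
apply: (Hup z') => //; move=> i id; by rewrite z'E // zi // geq_minl.
Qed.

Lemma cofree_restrict (H : pred (os n.+1 d.+1)) w : tors_closed X H -> X w -> cofree H w = H w.
Proof.
case=> _ Hup _ Xw; apply/cofreeP/idP => [Hw|Hw v Xv vd wv]; first exact: Hw.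
exact: Hup Hw vd wv.
Qed.

Definition same_restriction T T' : bool :=
  [forall w : os n.+1 d.+1, X w ==> (tam_pred T w == tam_pred T' w)].

Lemma same_restrictionP T T' :
  reflect (forall w, X w -> tam_pred T w = tam_pred T' w) (same_restriction T T').
Proof.
apply: (iffP forallP) => [H w Xw|H w]; last by apply/implyP => /H ->.
by have := H w; rewrite Xw => /eqP.
Qed.

Lemma tam_pred_meet T T' w : tam_pred (T `&` T')%O w = tam_pred T w && tam_pred T' w.
Proof. by rewrite /tam_pred /= in_setI. Qed.

(** T1 and T2 lie in the largest filter R whose restriction to X is contained in T, hence so does
    their join. *)
Lemma restriction_join T1 T2 T :
  (forall w, X w -> tam_pred T1 w -> tam_pred T w) ->
  (forall w, X w -> tam_pred T2 w -> tam_pred T w) ->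
  forall w, X w -> tam_pred (T1 `|` T2)%O w -> tam_pred T w.
Proof.
move=> H1 H2; have HC := tam_pred_closed T admX.
set H := [pred w | _] in HC; pose R := tam_of (cofree_closed HC).
have le S : (forall w, X w -> tam_pred S w -> tam_pred T w) -> (S <= R)%O.
  move=> HS; apply/tam_pred_leP => w wS; rewrite tam_ofE; apply/cofreeP => v Xv vd wv.
  rewrite /H /= Xv HS //.
  have [_ Sup _] : tors_closed predT [pred w | predT w && tam_pred S w].
    by apply: tam_pred_closed.
  exact: (Sup w v wS vd wv).
have : (T1 `|` T2 <= R)%O by rewrite leUx !le.
move=> /tam_pred_leP TR w Xw /TR; rewrite tam_ofE cofree_restrict //.
by case/andP.
Qed.

Lemma same_refl : reflexive same_restriction.
Proof. by move=> T; apply/same_restrictionP. Qed.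
Lemma same_sym : symmetric same_restriction.
Proof.
by move=> T T'; apply/same_restrictionP/same_restrictionP => H w Xw; rewrite H.
Qed.
Lemma same_trans : transitive same_restriction.
Proof.
move=> T T1 T2 /same_restrictionP H1 /same_restrictionP H2.
by apply/same_restrictionP => w Xw; rewrite H1 // H2.
Qed.
Lemma same_meet T1 T1' T2 T2' : same_restriction T1 T1' -> same_restriction T2 T2' ->
  same_restriction (T1 `&` T2)%O (T1' `&` T2')%O.
Proof.
move=> /same_restrictionP H1 /same_restrictionP H2; apply/same_restrictionP => w Xw.
by rewrite !tam_pred_meet H1 // H2.
Qed.
Lemma same_join T1 T1' T2 T2' : same_restriction T1 T1' -> same_restriction T2 T2' ->
  same_restriction (T1 `|` T2)%O (T1' `|` T2')%O.
Proof.
have le S1 S1' S2 S2' : same_restriction S1 S1' -> same_restriction S2 S2' ->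
    forall w, X w -> tam_pred (S1 `|` S2)%O w -> tam_pred (S1' `|` S2')%O w.
  move=> /same_restrictionP H1 /same_restrictionP H2; apply: restriction_join => w Xw.
    by rewrite H1 //; apply: (tam_pred_leP _ _).1; apply: leUl.
  by rewrite H2 //; apply: (tam_pred_leP _ _).1; apply: leUr.
move=> H1 H2; apply/same_restrictionP => w Xw; apply/idP/idP; first exact: le H1 H2 w Xw.
by apply: (le _ _ _ _ _ _ w Xw); rewrite same_sym.
Qed.

Definition restriction_congruence : congruence (Tam phi) :=
  Congruence same_refl same_sym same_trans same_meet same_join.

End Restriction.

End TamariCorrespondence.

(** * Torsion classes correspond to closed sets, compatibly with inclusion *)

Section TorsionClassLattices.
Variables (K : fieldType) (n d : nat) (X : pred (os n d.+1)).
Hypothesis d0 : (0 < d)%N.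
Hypothesis admX : admissible X.
Variable M : module K n d -> Prop.
Hypothesis MX : forall V, M V <-> in_add X V.

Lemma tors_set_leP (U U' : torsion_class M) :
  (forall V, U V -> U' V) <-> (forall x, tors_set U x -> tors_set U' x).
Proof.
split=> [UU' x /asboolP/UU' ?|FF' V /(torsE d0 MX) VF]; first exact/asboolP.
by apply/(torsE d0 MX); apply: in_add_sub VF.
Qed.

Lemma tors_class_of_set F : tors_closed X F ->
  exists U : torsion_class M, forall x, tors_set U x = F x.
Proof.
move=> FC; have FX : forall x, F x -> X x by case: FC.
have sub V : in_add F V -> M V by move=> VF; apply/MX; apply: in_add_sub VF.
have iso (V W : module K n d) : mod_iso V W -> in_add F V -> in_add F W.
  by move=> /mod_iso_sym; apply: in_add_iso.
have zero : in_add F (mod0 K n d) by apply: in_add_zero; apply: mod0_zero.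
have seqs V : M V -> torsion_seq M (in_add F) V.
  move=> /MX VX; apply: torsion_seq_sub (torsion_seq_in_add d0 admX FC VX) => //.
  by move=> W /MX.
exists (TorsionClass sub iso zero (@in_add_sum _ _ _ F) (@in_add_summand _ _ _ F) seqs).
by move=> x; apply/tors_setP/idP => /= /(in_add_thinP _ d0).
Qed.

End TorsionClassLattices.

(** m - l_m is non-decreasing in m because l_(m+1) <= l_m + 1; the inner claim states this without
    subtraction. *)
Lemma kupisch_admissible n d (l : n.-tuple nat) :
  kupisch l -> admissible (@os_kupisch n d l).
Proof.
case=> _ _ lS x v; rewrite /os_kupisch => Xx xv vx.
suff : forall m, (ent v d <= m)%N -> (m < n)%N ->
    (nth 0 l m + ent v d <= nth 0 l (ent v d) + m)%N.
  by move=> /(_ (ent x d) vx (ent_lt x (ltnSn d))); lia.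
elim=> [|m IH]; first by rewrite leqn0 => /eqP ->.
rewrite leq_eqVlt => /orP[/eqP <-|]; first by [].
rewrite ltnS => vm mn; have := IH vm (ltnW mn); have /andP[_] := lS m.+1 mn.
by rewrite /=; lia.
Qed.

Local Close Scope ring_scope.

Theorem theorem5p12 (K : fieldType) (d n : nat) (l : n.-tuple nat) :
  0 < d -> 0 < n -> kupisch l ->
  exists (disp disp' : Order.disp_t) (L : finLatticeType disp)
      (Ll : finLatticeType disp'),
    torsion_lattice (@auslander_M K n d) L /\
    torsion_lattice (@nakayama_M K n d l) Ll /\
    lattice_quotient L Ll /\
    (forall Q : lattice_property,
       iso_invariant Q -> quotient_preserved Q ->
       (forall dP (P : finBPOrderType dP) (phi : bot_chain P), Q _ (Tam phi)) ->
       Q _ Ll) /\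
    join_semidistributive Ll.
Proof.
move=> d0; case: n l => // n l _ kl.
have admL := kupisch_admissible (d := d) kl.
have admT : admissible (predT : pred (os n.+1 d.+1)) by [].
have MT := @add_MxP K n.+1 d d0 predT; have ML V := @nakayama_MP K n.+1 d d0 l V.
have FT := tors_set_closed d0 admT MT; have FL := tors_set_closed d0 admL ML.
pose c := restriction_congruence d0 admL.
(* The second lattice is taken to be the quotient itself, so the quotient statement holds by the
   identity, and the work lies in matching it with torsion classes. *)
exists _, _, (Tam (const_chain n d0)), (lquot c); split.
  exists (fun U => tam_of d0 (FT U)); split=> [U U'|T].
    apply: iff_trans (tors_set_leP d0 MT U U') _.
    apply: iff_trans _ (iff_sym (tam_pred_leP _ _)).
    by split=> H w; have := H w; rewrite !tam_ofE.
  have TC := tam_pred_closed T admT.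
  have [U UE] := tors_class_of_set d0 admT MT TC; exists U.
  by apply/le_anti/andP; split; apply/tam_pred_leP => w; rewrite tam_ofE UE.
split.
  (* A closed set is represented by its cofree extension; the order of the quotient then compares
     restrictions, that is, the closed sets themselves. *)
  exists (fun U => \pi_(lquot c)%qT (tam_of d0 (cofree_closed d0 admL (FL U)))).
  split=> [U U'|b].
    apply: iff_trans (tors_set_leP d0 ML U U') _.
    have FLX (W : torsion_class (@nakayama_M K n.+1 d l)) w : tors_set W w -> os_kupisch l w.
      by case: (FL W) => H _ _; apply: H.
    rewrite lquot_leE; split=> [H|/same_restrictionP H w Fw].
      apply/same_restrictionP => w Xw; rewrite tam_pred_meet !tam_ofE.
      rewrite !(cofree_restrict (FL _)) //; apply: andb_idr; exact: H.
    have Xw := FLX _ _ Fw; have := H w Xw; rewrite tam_pred_meet !tam_ofE.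
    by rewrite !(cofree_restrict (FL _)) // Fw.
  (* The torsion class is that of the restriction of [T], whose cofree extension lies in the class
     of [T]. *)
  have [T ->] := lquotP b; have TC := tam_pred_closed T admL.
  have [U UE] := tors_class_of_set d0 admL ML TC; exists U.
  apply/eqP; rewrite lquot_eq; apply/same_restrictionP => w Xw.
  by rewrite tam_ofE (cofree_restrict (FL _)) // UE /= Xw.
split; first by exists c, id => //; exists id.
split=> [Q _ Qquot QTam|]; first exact/Qquot/QTam.
exact/lquot_join_semidistributive/tam_join_semidistributive.
Qed.
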